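(* Let $p=p_n\in(0,1)$ and let $x=x_n$ be non-negative integers such that, as $n\to\infty$, $p\to0$, $np\to\infty$ and $|x-n\alpha|=o\big(\min(np,\,n^{2/3})\big)$. Then $$\frac{P(\tilde S=x)}{\mathrm{BI}(N,\tilde p)\{x\}}=1+o(1)\quad(n\to\infty).$$
   Context: $\eta_1,\dots,\eta_{n+1}$ are i.i.d. Bernoulli random variables with $P(\eta_1=1)=p=1-P(\eta_1=0)$, and $\tilde S=\sum_{j=1}^n\eta_j(1-\eta_{j+1})$. $\alpha=p(1-p)$. $\tilde N=\frac{n^2}{3n-2}$, $N=\lfloor\tilde N\rfloor$, $\tilde p=n\alpha/N$. $\mathrm{BI}(N,\tilde p)\{k\}=\binom Nk\tilde p^k(1-\tilde p)^{N-k}$ is the binomial distribution. *)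

(* Defs.v *)
From Stdlib Require Import Reals List.
Import ListNotations.
Open Scope R_scope.

Fixpoint all_bits (m : nat) : list (list bool) :=
  match m with
  | O => [ [] ]
  | S k => map (cons true) (all_bits k) ++ map (cons false) (all_bits k)
  end.

Fixpoint bern_weight (p : R) (s : list bool) : R :=
  match s with
  | [] => 1
  | b :: t => (if b then p else 1 - p) * bern_weight p t
  end.

Fixpoint S_stat (s : list bool) : nat :=
  match s with
  | true :: ((false :: _) as t) => S (S_stat t)
  | _ :: t => S_stat t
  | [] => O
  end.

(* P(S~ = x) where S~ = sum_{j=1}^n eta_j (1 - eta_{j+1}), eta_1..eta_{n+1}
   i.i.d. Bernoulli(p). *)
Definition prob_S (n : nat) (p : R) (x : nat) : R :=
  fold_right Rplus 0
    (map (fun s => if Nat.eqb (S_stat s) x then bern_weight p s else 0)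
         (all_bits (S n))).

Definition alpha (p : R) : R := p * (1 - p).

Definition Ntilde (n : nat) : R := (INR n)^2 / (3 * INR n - 2).
Definition Nfl (n : nat) : nat := Z.to_nat (Int_part (Ntilde n)).
Definition ptilde (n : nat) (p : R) : R := INR n * alpha p / INR (Nfl n).

Definition BI (N : nat) (q : R) (k : nat) : R :=
  if Nat.leb k N then C N k * q ^ k * (1 - q) ^ (N - k) else 0.

(* Main.v *)
Require Import Defs.
From Stdlib Require Import Reals Lra Lia List ZArith Wf_nat.
Import ListNotations.
Open Scope R_scope.

(* Set w = alpha (z - 1). The generating function of the number S of runs is the Fibonacci
   polynomial F_(n+1)(w), where F_(m+2) = F_(m+1) + w F_m, and it factors as the product of
   the 1 + 4 w cos^2 (j pi / (n + 2)). Hence S has the law of a sum of independent Bernoulli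
   variables with parameters q_j = 4 alpha cos^2 (j pi / (n + 2)) -> 0, with sum n alpha and
   sum of squares (3 n - 2) alpha^2, so the problem is to compare two Poisson-binomial laws
   with equal means m and almost equal variances.

   Let P be such a law and A_j the law without the j-th summand. From
   x P(x) = sum_j q_j A_j(x-1) and A_j = P + q_j DP + q_j^2 D^2 A_j, where
   Df(x) = f(x) - f(x-1), inductions on x bound DP and D^2 A_j relative to P, and then
     x P(x) = m P(x-1) + (sum_j q_j^2) DP(x-1) + O(b^2 m (((|m-x|+1)/m)^2 + 1/m)) P(x)
   for q_j <= b and x <= 3m/2. The quotients P(x-1)/P(x) of the two laws thus differ by
   O(((m-x)^2+1)/n^2 + alpha/n), so the ratio of the laws is almost constant on the window
   |x - m| <= D as soon as D^3/n^2 and alpha are small. Both laws concentrate on the window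
   of width sqrt m, where the constant must therefore be close to 1. *)

(** * Sums over lists, Poisson-binomial mass functions and the size-bias identity *)

Definition lsum {T : Type} (g : T -> R) (l : list T) : R :=
  fold_right (fun a s => g a + s) 0 l.

Lemma lsum_ext {T : Type} (g h : T -> R) (l : list T) :
  (forall a, In a l -> g a = h a) -> lsum g l = lsum h l.
Proof.
  induction l as [|a l IH]; simpl; intros H; [reflexivity|].
  rewrite (H a), IH; auto.
Qed.

Lemma lsum_plus {T : Type} (g h : T -> R) (l : list T) :
  lsum (fun a => g a + h a) l = lsum g l + lsum h l.
Proof. induction l as [|a l IH]; simpl; [ring|]. rewrite IH; ring. Qed.

Lemma lsum_scal {T : Type} (k : R) (g : T -> R) (l : list T) :
  lsum (fun a => k * g a) l = k * lsum g l.
Proof. induction l as [|a l IH]; simpl; [ring|]. rewrite IH; ring. Qed.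

Lemma lsum_map {S T : Type} (f : S -> T) (g : T -> R) (l : list S) :
  lsum g (map f l) = lsum (fun a => g (f a)) l.
Proof. induction l as [|a l IH]; simpl; [ring|]. rewrite IH; ring. Qed.

Lemma lsum_app {T : Type} (g : T -> R) (l l' : list T) :
  lsum g (l ++ l') = lsum g l + lsum g l'.
Proof. induction l as [|a l IH]; simpl; [ring|]. rewrite IH; ring. Qed.

Lemma lsum_le {T : Type} (g h : T -> R) (l : list T) :
  (forall a, In a l -> g a <= h a) -> lsum g l <= lsum h l.
Proof.
  induction l as [|a l IH]; simpl; intros H; [lra|].
  apply Rplus_le_compat; auto.
Qed.

Lemma Rabs_lsum_le {T : Type} (g h : T -> R) (X : R) (l : list T) :
  (forall a, In a l -> Rabs (g a) <= h a * X) -> Rabs (lsum g l) <= lsum h l * X.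
Proof.
  induction l as [|a l IH]; simpl; intros H.
  - rewrite Rabs_R0; lra.
  - eapply Rle_trans; [apply Rabs_triang|].
    rewrite Rmult_plus_distr_r; apply Rplus_le_compat; auto.
Qed.

(** [f (x - 1)], where a mass function is taken to vanish at negative integers. *)
Definition shift (f : nat -> R) (x : nat) : R :=
  match x with O => 0 | S y => f y end.

Definition diff (f : nat -> R) (x : nat) : R := f x - shift f x.

Definition conv (q : R) (f : nat -> R) (x : nat) : R :=
  q * shift f x + (1 - q) * f x.

Fixpoint pbin (l : list R) : nat -> R :=
  match l with
  | [] => fun x => match x with O => 1 | S _ => 0 end
  | q :: t => conv q (pbin t)
  end.

(* The pairs [(q_j, A_j)], where [A_j] is the mass function without the j-th summand. *)
Fixpoint leave_one_out (l : list R) : list (R * (nat -> R)) :=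
  match l with
  | [] => []
  | q :: t =>
      (q, pbin t) :: map (fun c => (fst c, conv q (snd c))) (leave_one_out t)
  end.

Lemma shift_ext (f g : nat -> R) (x : nat) :
  (forall y, f y = g y) -> shift f x = shift g x.
Proof. intros H; destruct x; simpl; auto. Qed.

Lemma conv_ext (q : R) (f g : nat -> R) (x : nat) :
  (forall y, f y = g y) -> conv q f x = conv q g x.
Proof. intros H; unfold conv; rewrite H, (shift_ext f g); auto. Qed.

Lemma conv_comm (q r : R) (f : nat -> R) (x : nat) :
  conv q (conv r f) x = conv r (conv q f) x.
Proof. destruct x as [|[|x]]; unfold conv; simpl; ring. Qed.

Lemma conv_nonneg (q : R) (f : nat -> R) :
  0 <= q <= 1 -> (forall x, 0 <= f x) -> forall x, 0 <= conv q f x.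
Proof.
  intros Hq Hf x; unfold conv.
  apply Rplus_le_le_0_compat; apply Rmult_le_pos; auto; try lra.
  destruct x; simpl; [lra|auto].
Qed.

Lemma pbin_nonneg (l : list R) :
  (forall q, In q l -> 0 <= q <= 1) -> forall x, 0 <= pbin l x.
Proof.
  induction l as [|q t IH]; intros H x.
  - destruct x; simpl; lra.
  - apply conv_nonneg; [apply H; left; auto|]. apply IH; intros; apply H; right; auto.
Qed.

Lemma pbin_0_pos (l : list R) :
  (forall q, In q l -> q < 1) -> 0 < pbin l 0.
Proof.
  induction l as [|q t IH]; intros H; simpl; [lra|].
  unfold conv; simpl. assert (q < 1) by (apply H; left; auto).
  assert (0 < pbin t 0) by (apply IH; intros; apply H; right; auto). nra.
Qed.

Lemma leave_one_out_fst (l : list R) :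
  lsum fst (leave_one_out l) = lsum (fun q => q) l.
Proof.
  induction l as [|q t IH]; simpl; [reflexivity|].
  rewrite lsum_map; simpl; rewrite <- IH; reflexivity.
Qed.

Lemma leave_one_out_sq (l : list R) :
  lsum (fun c => fst c * fst c) (leave_one_out l) = lsum (fun q => q * q) l.
Proof.
  induction l as [|q t IH]; simpl; [reflexivity|].
  rewrite lsum_map; simpl; rewrite <- IH; reflexivity.
Qed.

(** Convolutions commute, so any summand may be treated as the last one added. *)
Lemma leave_one_out_in (l : list R) (c : R * (nat -> R)) :
  In c (leave_one_out l) ->
  In (fst c) l /\ (forall x, pbin l x = conv (fst c) (snd c) x).
Proof.
  revert c; induction l as [|q t IH]; simpl; intros c; [tauto|].
  intros [<-|H]; [simpl; auto|].
  apply in_map_iff in H; destruct H as [d [<- Hd]]; simpl.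
  destruct (IH d Hd) as [H1 H2]; split; [auto|intros x].
  rewrite conv_comm; apply conv_ext; auto.
Qed.

Lemma leave_one_out_nonneg (l : list R) (c : R * (nat -> R)) :
  (forall q, In q l -> 0 <= q <= 1) ->
  In c (leave_one_out l) -> forall x, 0 <= snd c x.
Proof.
  revert c; induction l as [|q t IH]; simpl; intros c Hl; [tauto|].
  intros [<-|H]; [apply pbin_nonneg; auto|].
  apply in_map_iff in H; destruct H as [d [<- Hd]]; simpl.
  apply conv_nonneg; auto.
Qed.

(** Double counting: [x P(X = x)] is the sum over [j] of [P(X_j = 1, X = x)], and once [X_j = 1] the
    other summands must add up to [x - 1]. *)
Lemma size_bias (l : list R) (x : nat) :
  INR x * pbin l x = lsum (fun c => fst c * shift (snd c) x) (leave_one_out l).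
Proof.
  revert x; induction l as [|q t IH]; intros x.
  - destruct x; simpl; ring.
  - simpl leave_one_out; simpl; rewrite lsum_map; simpl.
    rewrite (lsum_ext _ (fun c => q * (fst c * shift (shift (snd c)) x)
                          + (1 - q) * (fst c * shift (snd c) x))).
    2:{ intros c _; destruct x as [|x]; simpl; [ring|unfold conv; ring]. }
    rewrite lsum_plus, !lsum_scal, <- IH; unfold conv.
    destruct x as [|x].
    + simpl; rewrite (lsum_ext _ (fun c => 0 * fst c)) by (intros; ring).
      rewrite lsum_scal; ring.
    + change (shift (pbin t) (S x)) with (pbin t x).
      rewrite (lsum_ext _ (fun c => fst c * shift (snd c) x)) by reflexivity.
      rewrite <- IH, S_INR; ring.
Qed.

(** * Differences of a Poisson-binomial mass function *)

Definition small_list (b : R) (l : list R) : Prop := forall q, In q l -> 0 <= q <= b.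

(** The scale of the relative first difference [diff P x / P x]. The [+ 1] makes values at
    neighbouring points comparable, even near the mean. *)
Definition dev (m : R) (x : nat) : R := (Rabs (m - INR x) + 1) / m.

(** Carries an induction hypothesis from [x - 1] to [x]: moving [F] costs a factor [k], moving [P] a
    factor 2. *)
Lemma Rabs_shift_le (k K : R) (F f P : nat -> R) (x : nat) :
  0 <= k -> 0 <= K * F x ->
  (forall y, x = S y -> F y <= k * F x) ->
  0 <= K -> 0 <= P x -> 0 <= shift P x <= 2 * P x ->
  (forall y, x = S y -> Rabs (f y) <= K * F y * P y) ->
  Rabs (shift f x) <= 2 * k * K * F x * P x.
Proof.
  intros Hk HF Hs HK HP HP2 Hf; destruct x as [|y]; simpl in *.
  - rewrite Rabs_R0.
    assert (0 <= (K * F 0%nat) * P 0%nat) by (apply Rmult_le_pos; lra). nra.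
  - eapply Rle_trans; [apply Hf; auto|].
    assert (K * F y <= K * (k * F (S y))) by (apply Rmult_le_compat_l; auto).
    assert (0 <= k * (K * F (S y))) by (apply Rmult_le_pos; lra).
    eapply Rle_trans; [apply Rmult_le_compat_r; [lra|apply H]|].
    replace (K * (k * F (S y)) * P y) with (k * (K * F (S y)) * P y) by ring.
    replace (2 * k * K * F (S y) * P (S y)) with (k * (K * F (S y)) * (2 * P (S y))) by ring.
    apply Rmult_le_compat_l; lra.
Qed.

(* Each [snd c x] is at least [3/4 * pbin l x] once [pbin l (x - 1) <= 2 * pbin l x],
   so the lower bound on [pbin l (x + 1)] given by [size_bias] propagates from left
   to right. *)
Lemma pbin_ratio (l : list R) (b : R) (x : nat) :
  let m := lsum (fun q => q) l in
  b <= 1/100 -> small_list b l -> 0 < m -> INR x <= 3 / 2 * m ->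
  0 < pbin l x /\ 0 <= shift (pbin l) x <= 2 * pbin l x.
Proof.
  intros m Hb Hl Hm.
  assert (Hl1 : forall q, In q l -> 0 <= q <= 1) by (intros q Hq; specialize (Hl q Hq); lra).
  induction x as [|x IH]; intros Hx.
  - assert (0 < pbin l 0) by (apply pbin_0_pos; intros q Hq; specialize (Hl q Hq); lra).
    simpl shift; lra.
  - rewrite S_INR in Hx. destruct IH as [IP IS]; [lra|].
    simpl shift.
    assert (H : 3/4 * m * pbin l x <= INR (S x) * pbin l (S x)).
    { rewrite size_bias; simpl.
      unfold m; rewrite <- (leave_one_out_fst l).
      replace (3/4 * lsum fst (leave_one_out l) * pbin l x)
        with (3/4 * pbin l x * lsum fst (leave_one_out l)) by ring.
      rewrite <- lsum_scal; apply lsum_le; intros c Hc.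
      destruct (leave_one_out_in l c Hc) as [Hq HA].
      pose proof (leave_one_out_nonneg l c Hl1 Hc) as HA0.
      specialize (Hl _ Hq).
      assert (Hs : 0 <= shift (snd c) x /\ (1 - fst c) * shift (snd c) x <= shift (pbin l) x).
      { destruct x as [|y]; simpl; [lra|]. split; [auto|].
        rewrite HA; unfold conv.
        assert (0 <= shift (snd c) y) by (destruct y; simpl; [lra|auto]). nra. }
      pose proof (HA x) as E; unfold conv in E.
      assert (3/4 * pbin l x <= snd c x).
      { pose proof (HA0 x). nra. }
      nra. }
    rewrite S_INR in H.
    (* Since [x + 1 <= 3/2 * m], the constant [3/4] in [H] becomes exactly the factor 2. *)
    assert (pbin l x <= 2 * pbin l (S x)).
    { pose proof (pbin_nonneg l Hl1 (S x)). nra. }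
    lra.
Qed.

Lemma dev_pos (m : R) (x : nat) : 0 < m -> 0 < dev m x.
Proof.
  intros Hm; unfold dev; apply Rdiv_lt_0_compat; auto.
  pose proof (Rabs_pos (m - INR x)); lra.
Qed.

Lemma dev_pred (m : R) (y : nat) : 0 < m -> dev m y <= 2 * dev m (S y).
Proof.
  intros Hm; unfold dev, Rdiv.
  rewrite <- Rmult_assoc; apply Rmult_le_compat_r.
  - left; apply Rinv_0_lt_compat; auto.
  - rewrite S_INR.
    replace (m - INR y) with ((m - (INR y + 1)) + 1) by ring.
    pose proof (Rabs_triang (m - (INR y + 1)) 1). rewrite Rabs_R1 in H.
    pose proof (Rabs_pos (m - (INR y + 1))); lra.
Qed.

(* From [P = q * shift A + (1 - q) * A] one gets [A = P + q * diff A], and, iterating,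
   [A = P + q * diff P + q ^ 2 * diff (diff A)]. *)
Lemma shift_leave_one_out (l : list R) (c : R * (nat -> R)) (x : nat) :
  In c (leave_one_out l) ->
  shift (snd c) x = shift (pbin l) x + fst c * shift (diff (snd c)) x.
Proof.
  intros Hc; destruct (leave_one_out_in l c Hc) as [_ H].
  destruct x as [|x]; simpl; [ring|]. rewrite H; unfold conv, diff; ring.
Qed.

Lemma shift_leave_one_out2 (l : list R) (c : R * (nat -> R)) (x : nat) :
  In c (leave_one_out l) ->
  shift (snd c) x = shift (pbin l) x + fst c * shift (diff (pbin l)) x
                    + fst c * fst c * shift (diff (diff (snd c))) x.
Proof.
  intros Hc; rewrite (shift_leave_one_out l c x Hc).
  destruct x as [|x]; simpl; [ring|]. unfold diff at 2 3.
  pose proof (shift_leave_one_out l c x Hc).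
  destruct (leave_one_out_in l c Hc) as [_ H1].
  specialize (H1 x); unfold conv in H1. unfold diff in *. rewrite H1.
  replace (shift (pbin l) x) with (shift (snd c) x - fst c * shift (diff (snd c)) x) by (unfold diff; lra).
  unfold diff; ring.
Qed.

(** [size_bias] with the first-order expansion of each [A_j] inserted. The main term [(m - x) P(x)]
    explains the form of [dev]. *)
Lemma diff_pbin (l : list R) (x : nat) :
  let m := lsum (fun q => q) l in
  m * diff (pbin l) x =
    (m - INR x) * pbin l x
    + lsum (fun c => fst c * fst c * shift (diff (snd c)) x) (leave_one_out l).
Proof.
  intros m.
  assert (E : INR x * pbin l x = m * shift (pbin l) x +
    lsum (fun c => fst c * fst c * shift (diff (snd c)) x) (leave_one_out l)).
  { rewrite size_bias.
    rewrite (lsum_ext _ (fun c => shift (pbin l) x * fst c + fst c * fst c * shift (diff (snd c)) x)).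
    - rewrite lsum_plus, lsum_scal, (leave_one_out_fst l); unfold m; ring.
    - intros c Hc; rewrite (shift_leave_one_out l c x Hc); ring. }
  unfold diff at 1; lra.
Qed.

(** The difference of [diff_pbin] at [x] and [x - 1]; the extra [- P(x - 1)] comes from differencing
    the factor [m - x]. *)
Lemma diff2_pbin (l : list R) (x : nat) :
  let m := lsum (fun q => q) l in
  m * diff (diff (pbin l)) x =
    (m - INR x) * diff (pbin l) x - shift (pbin l) x
    + lsum (fun c => fst c * fst c * shift (diff (diff (snd c))) x) (leave_one_out l).
Proof.
  intros m; destruct x as [|y].
  - pose proof (diff_pbin l 0) as H; simpl in H |- *; fold m in H.
    unfold diff at 1; simpl.
    rewrite (lsum_ext _ (fun c => 0 * fst c)) in H by (intros; ring).
    rewrite (lsum_ext _ (fun c => 0 * fst c)) by (intros; ring).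
    rewrite lsum_scal in H |- *. unfold diff in *; simpl in *; lra.
  - pose proof (diff_pbin l (S y)) as H1; pose proof (diff_pbin l y) as H2.
    fold m in H1, H2. simpl in H1, H2.
    unfold diff at 1; simpl shift.
    rewrite (lsum_ext _ (fun c => fst c * fst c * diff (snd c) y
       + (-1) * (fst c * fst c * shift (diff (snd c)) y)))
      by (intros; simpl; unfold diff at 1; ring).
    rewrite lsum_plus, lsum_scal, Rmult_minus_distr_l, H1, H2.
    unfold diff at 3; simpl shift. rewrite S_INR; change (match y with O => 1 | S _ => INR y + 1 end) with (INR (S y)); rewrite S_INR. ring.
Qed.

Lemma Rabs_le_inv (a b : R) : Rabs a <= b -> - b <= a <= b.
Proof. unfold Rabs; destruct (Rcase_abs a); lra. Qed.

(** Solving for [w] gives [(1 - q) |w| <= (3/5 + 8/100) X], well below [99/100 * X]. This recovers a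
    bound on [A_j] at [x] from [P] at [x] and [A_j] at [x - 1]. *)
Lemma diff_recover (q b X u v w : R) :
  0 <= q <= b -> b <= 1/100 -> u = q * v + (1 - q) * w -> 0 <= X ->
  Rabs u <= 3/5 * X -> Rabs v <= 8 * X -> Rabs w <= X.
Proof.
  intros Hq Hb E HX Hu Hv.
  apply Rabs_le_inv in Hu; apply Rabs_le_inv in Hv.
  assert (-(8/100 * X) <= q * v <= 8/100 * X) by (split; nra).
  apply Rabs_le; split; nra.
Qed.

Lemma diff_leave_one_out (l : list R) (c : R * (nat -> R)) (x : nat) :
  In c (leave_one_out l) ->
  diff (pbin l) x = fst c * shift (diff (snd c)) x + (1 - fst c) * diff (snd c) x.
Proof.
  intros Hc; destruct (leave_one_out_in l c Hc) as [_ H].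
  unfold diff at 1; rewrite H.
  destruct x as [|x]; simpl; [|rewrite H]; unfold conv, diff; simpl; ring.
Qed.

Lemma diff2_leave_one_out (l : list R) (c : R * (nat -> R)) (x : nat) :
  In c (leave_one_out l) ->
  diff (diff (pbin l)) x = fst c * shift (diff (diff (snd c))) x
                           + (1 - fst c) * diff (diff (snd c)) x.
Proof.
  intros Hc; unfold diff at 1; rewrite (diff_leave_one_out l c x Hc).
  destruct x as [|x]; simpl; [|rewrite (diff_leave_one_out l c x Hc)];
    unfold diff; simpl; ring.
Qed.

(** Bootstrap by strong induction. The constant 2 for [A_j] at [x - 1] becomes [8 = 2 * 2 * 2] at
    [x], but enters [diff_pbin] with weight [b <= 1/100]. So [diff P] costs at most
    [1 + 8/100 <= 3/5 * 2], and [diff_recover] restores the constant 2 for [A_j]. *)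
Lemma diff_pbin_bound (l : list R) (b : R) (x : nat) :
  let m := lsum (fun q => q) l in
  b <= 1/100 -> small_list b l -> 0 < m -> INR x <= 3 / 2 * m ->
  Rabs (diff (pbin l) x) <= 2 * dev m x * pbin l x /\
     (forall c, In c (leave_one_out l) ->
     Rabs (diff (snd c) x) <= 2 * dev m x * pbin l x /\
     Rabs (shift (diff (snd c)) x) <= 8 * dev m x * pbin l x).
Proof.
  intros m Hb Hl Hm.
  induction x as [x IH] using (well_founded_induction lt_wf); intros Hx.
  destruct (pbin_ratio l b x Hb Hl Hm Hx) as [HP HS].
  pose proof (dev_pos m x Hm) as He.
  assert (Hs : forall c, In c (leave_one_out l) ->
     Rabs (shift (diff (snd c)) x) <= 8 * dev m x * pbin l x).
  { intros c Hc. replace 8 with (2 * 2 * 2) by ring.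
    apply (Rabs_shift_le 2 2); try lra.
    - intros y ->; apply dev_pred; auto.
    - intros y E. apply IH; auto; [lia|].
      rewrite E, S_INR in Hx; lra. }
  assert (HX : 0 < dev m x * pbin l x) by (apply Rmult_lt_0_compat; auto).
  assert (Hd : Rabs (diff (pbin l) x) <= 3/5 * (2 * dev m x * pbin l x)).
  { apply (Rmult_le_reg_l m); auto.
    rewrite <- (Rabs_pos_eq m) at 1 by lra. rewrite <- Rabs_mult.
    unfold m at 1; rewrite diff_pbin; fold m.
    eapply Rle_trans; [apply Rabs_triang|].
    eapply Rle_trans; [apply Rplus_le_compat_l, (Rabs_lsum_le _ fst (b * (8 * dev m x * pbin l x)))|].
    - intros c Hc; specialize (Hs c Hc).
      destruct (leave_one_out_in l c Hc) as [Hq _]; specialize (Hl _ Hq).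
      rewrite Rabs_mult, Rabs_pos_eq by nra. rewrite Rmult_assoc.
      apply Rmult_le_compat_l; [lra|]. apply Rmult_le_compat; try lra.
      apply Rabs_pos.
    - rewrite leave_one_out_fst; fold m.
      rewrite Rabs_mult, (Rabs_pos_eq (pbin l x)) by lra.
      assert (Rabs (m - INR x) <= m * dev m x).
      { unfold dev; replace (m * ((Rabs (m - INR x) + 1) / m)) with (Rabs (m - INR x) + 1)
          by (field; lra). lra. }
      assert (Rabs (m - INR x) * pbin l x <= m * dev m x * pbin l x)
        by (apply Rmult_le_compat_r; lra).
      assert (m * (b * (8 * dev m x * pbin l x)) <= m * (1/100 * (8 * dev m x * pbin l x))).
      { apply Rmult_le_compat_l; [lra|]. apply Rmult_le_compat_r; lra. }
      assert (0 < m * (dev m x * pbin l x)) by (apply Rmult_lt_0_compat; auto).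
      lra. }
  split; [lra|]. intros c Hc; split; [|auto].
  destruct (leave_one_out_in l c Hc) as [Hq _].
  apply (diff_recover (fst c) b (2 * dev m x * pbin l x) (diff (pbin l) x)
           (shift (diff (snd c)) x)); auto; try lra.
  - apply diff_leave_one_out; auto.
  - specialize (Hs c Hc); lra.
Qed.

(** The scale of the relative second difference: for the Gaussian density of mean and variance [m],
    the quotient [f'' / f] is [((x - m) / m)^2 - 1 / m]. *)
Definition dev2 (m : R) (x : nat) : R := dev m x ^ 2 + / m.

Lemma dev2_pos (m : R) (x : nat) : 0 < m -> 0 < dev2 m x.
Proof.
  intros Hm; unfold dev2. pose proof (dev_pos m x Hm).
  pose proof (Rinv_0_lt_compat m Hm). nra.
Qed.

Lemma dev2_pred (m : R) (y : nat) : 0 < m -> dev2 m y <= 4 * dev2 m (S y).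
Proof.
  intros Hm; unfold dev2. pose proof (dev_pos m y Hm). pose proof (dev_pred m y Hm).
  pose proof (Rinv_0_lt_compat m Hm). nra.
Qed.

(** The same bootstrap one order higher, with [32 = 2 * 4 * 4]. The first-difference bound controls
    the main terms of [diff2_pbin] by [2 * dev2], and [2 + 32/100 <= 3/5 * 4]. *)
Lemma diff2_pbin_bound (l : list R) (b : R) (x : nat) :
  let m := lsum (fun q => q) l in
  b <= 1/100 -> small_list b l -> 0 < m -> INR x <= 3 / 2 * m ->
  forall c, In c (leave_one_out l) ->
     Rabs (diff (diff (snd c)) x) <= 4 * dev2 m x * pbin l x /\
     Rabs (shift (diff (diff (snd c))) x) <= 32 * dev2 m x * pbin l x.
Proof.
  intros m Hb Hl Hm.
  induction x as [x IH] using (well_founded_induction lt_wf); intros Hx.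
  destruct (pbin_ratio l b x Hb Hl Hm Hx) as [HP HS].
  pose proof (dev2_pos m x Hm) as He. pose proof (dev_pos m x Hm) as He1.
  destruct (diff_pbin_bound l b x Hb Hl Hm Hx) as [Hd1 _]; fold m in Hd1.
  assert (Hs : forall c, In c (leave_one_out l) ->
     Rabs (shift (diff (diff (snd c))) x) <= 32 * dev2 m x * pbin l x).
  { intros c Hc. replace 32 with (2 * 4 * 4) by ring.
    apply (Rabs_shift_le 4 4); try lra.
    - intros y ->; apply dev2_pred; auto.
    - intros y E. apply IH; auto; [lia|].
      rewrite E, S_INR in Hx; lra. }
  assert (HX : 0 < dev2 m x * pbin l x) by (apply Rmult_lt_0_compat; auto).
  assert (Hd : Rabs (diff (diff (pbin l)) x) <= 3/5 * (4 * dev2 m x * pbin l x)).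
  { apply (Rmult_le_reg_l m); auto.
    rewrite <- (Rabs_pos_eq m) at 1 by lra. rewrite <- Rabs_mult.
    unfold m at 1; rewrite diff2_pbin; fold m.
    eapply Rle_trans; [apply Rabs_triang|].
    eapply Rle_trans; [apply Rplus_le_compat_l, (Rabs_lsum_le _ fst (b * (32 * dev2 m x * pbin l x)))|].
    - intros c Hc; specialize (Hs c Hc).
      destruct (leave_one_out_in l c Hc) as [Hq _]; specialize (Hl _ Hq).
      rewrite Rabs_mult, Rabs_pos_eq by nra. rewrite Rmult_assoc.
      apply Rmult_le_compat_l; [lra|]. apply Rmult_le_compat; try lra.
      apply Rabs_pos.
    - rewrite leave_one_out_fst; fold m.
      assert (A1 : Rabs ((m - INR x) * diff (pbin l) x - shift (pbin l) x)
                 <= m * (2 * (dev2 m x * pbin l x))).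
      { unfold Rminus at 1; eapply Rle_trans; [apply Rabs_triang|].
        rewrite Rabs_Ropp, Rabs_mult, (Rabs_pos_eq (shift _ x)) by lra.
        assert (Rabs (m - INR x) <= m * dev m x).
        { unfold dev; replace (m * ((Rabs (m - INR x) + 1) / m)) with (Rabs (m - INR x) + 1)
            by (field; lra). lra. }
        assert (Rabs (m - INR x) * Rabs (diff (pbin l) x)
                <= (m * dev m x) * (2 * dev m x * pbin l x))
          by (apply Rmult_le_compat; auto; apply Rabs_pos).
        replace (m * (2 * (dev2 m x * pbin l x)))
          with ((m * dev m x) * (2 * dev m x * pbin l x) + 2 * pbin l x)
          by (unfold dev2; field; lra).
        lra. }
      assert (m * (b * (32 * dev2 m x * pbin l x)) <= m * (1/100 * (32 * dev2 m x * pbin l x))).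
      { apply Rmult_le_compat_l; [lra|]. apply Rmult_le_compat_r; lra. }
      assert (0 < m * (dev2 m x * pbin l x)) by (apply Rmult_lt_0_compat; auto).
      lra. }
  intros c Hc; split; [|auto].
  destruct (leave_one_out_in l c Hc) as [Hq _].
  apply (diff_recover (fst c) b (4 * dev2 m x * pbin l x) (diff (diff (pbin l)) x)
           (shift (diff (diff (snd c))) x)); auto; try lra.
  - apply diff2_leave_one_out; auto.
  - specialize (Hs c Hc); lra.
Qed.

(** Second-order expansion in [size_bias]; the remainder carries [q_j ^ 3 <= b ^ 2 * q_j]. Up to
    this error the recursion sees the law only through its first two power sums. *)
Lemma pbin_recursion (l : list R) (b : R) (x : nat) :
  let m := lsum (fun q => q) l in
  b <= 1/100 -> small_list b l -> 0 < m -> INR x <= 3 / 2 * m ->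
  Rabs (INR x * pbin l x - m * shift (pbin l) x
        - lsum (fun q => q * q) l * shift (diff (pbin l)) x)
    <= 32 * b ^ 2 * dev2 m x * m * pbin l x.
Proof.
  intros m Hb Hl Hm Hx.
  rewrite size_bias.
  rewrite (lsum_ext _ (fun c => shift (pbin l) x * fst c +
     (shift (diff (pbin l)) x * (fst c * fst c)
      + fst c * fst c * fst c * shift (diff (diff (snd c))) x))).
  2:{ intros c Hc; rewrite (shift_leave_one_out2 l c x Hc); ring. }
  rewrite !lsum_plus, !lsum_scal, leave_one_out_fst, leave_one_out_sq; fold m.
  match goal with |- Rabs ?u <= _ =>
    replace u with (lsum (fun c => fst c * fst c * fst c * shift (diff (diff (snd c))) x)
                      (leave_one_out l)) by ring end.
  replace (32 * b ^ 2 * dev2 m x * m * pbin l x)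
    with (lsum fst (leave_one_out l) * (b * b * (32 * dev2 m x * pbin l x)))
    by (rewrite leave_one_out_fst; fold m; ring).
  apply Rabs_lsum_le; intros c Hc.
  destruct (diff2_pbin_bound l b x Hb Hl Hm Hx c Hc) as [_ H]; fold m in H.
  destruct (leave_one_out_in l c Hc) as [Hq _]; specialize (Hl _ Hq).
  rewrite Rabs_mult, Rabs_pos_eq by (repeat apply Rmult_le_pos; lra).
  rewrite (Rmult_assoc (fst c)), (Rmult_assoc (fst c)).
  apply Rmult_le_compat_l; [lra|].
  apply Rmult_le_compat; auto; [nra|apply Rabs_pos|nra].
Qed.

(** * Comparison of two Poisson-binomial laws with the same mean *)

Lemma lsum_sq_bounds (l : list R) (b : R) :
  small_list b l -> 0 <= lsum (fun q => q * q) l <= b * lsum (fun q => q) l.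
Proof.
  induction l as [|q t IH]; intros H; simpl; [lra|].
  destruct IH as [H1 H2]; [intros r Hr; apply H; right; auto|].
  destruct (H q) as [H3 H4]; [left; auto|]. nra.
Qed.

(* [t], [s] and [t'], [s'] are the quotients [P (x - 1) / P x] of the two laws at [x] and
   [x - 1]; their difference is contracted by a factor of order [b]. *)
Lemma ratio_recursion_contract (t t' s s' m m2 m2' b E w x k e : R) :
  0 < m -> 0 <= m2 <= b * m -> b <= 1/100 ->
  0 <= t' <= 2 -> 0 <= s <= 2 -> 0 <= w -> 0 <= e -> 0 <= k ->
  Rabs (x - t * (m + m2 * (1 - s))) <= E * m ->
  Rabs (x - t' * (m + m2' * (1 - s'))) <= E * m ->
  Rabs (1 - s') <= 4 * e -> Rabs (s - s') <= 4 * w -> Rabs (m2 - m2') <= k * m ->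
  16 * k * e + 4 * E = w -> Rabs (t - t') <= w.
Proof.
  intros Hm Hm2 Hb Ht' Hs Hw He Hk H1 H2 H3 H4 H5 Ew.
  assert (H6 : Rabs (t' * (m2 * (s' - s))) <= 2 * (b * m * (4 * w))).
  { rewrite !Rabs_mult, (Rabs_pos_eq t'), (Rabs_pos_eq m2), (Rabs_minus_sym s') by lra.
    pose proof (Rabs_pos (s - s')).
    apply Rmult_le_compat; try lra; [nra|]. apply Rmult_le_compat; lra. }
  assert (H7 : Rabs (t' * ((m2 - m2') * (1 - s'))) <= 2 * (k * m * (4 * e))).
  { rewrite !Rabs_mult, (Rabs_pos_eq t') by lra.
    pose proof (Rabs_pos (m2 - m2')); pose proof (Rabs_pos (1 - s')).
    apply Rmult_le_compat; try lra; [nra|]. apply Rmult_le_compat; lra. }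
  assert (H8 : (t - t') * (m + m2 * (1 - s)) =
    - (x - t * (m + m2 * (1 - s))) + (x - t' * (m + m2' * (1 - s')))
    - t' * (m2 * (s' - s)) - t' * ((m2 - m2') * (1 - s'))) by ring.
  (* By the choice of [w] the right-hand side equals [m * (w / 2 + 8 * b * w)], which is below the
     [99/100 * m * w] needed at the end. *)
  assert (H9 : Rabs ((t - t') * (m + m2 * (1 - s)))
               <= 2 * (E * m) + 2 * (b * m * (4 * w)) + 2 * (k * m * (4 * e))).
  { rewrite H8.
    apply Rabs_le_inv in H1; apply Rabs_le_inv in H2;
    apply Rabs_le_inv in H6; apply Rabs_le_inv in H7. apply Rabs_le; lra. }
  assert (H10 : 99/100 * m <= m + m2 * (1 - s)) by nra.
  rewrite Rabs_mult, (Rabs_pos_eq (m + _)) in H9 by lra.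
  pose proof (Rabs_pos (t - t')) as H11.
  assert (b * m * (4 * w) <= 1/100 * m * (4 * w)).
  { apply Rmult_le_compat_r; [lra|]. apply Rmult_le_compat_r; lra. }
  assert (Rabs (t - t') * (99/100 * m) <= Rabs (t - t') * (m + m2 * (1 - s)))
    by (apply Rmult_le_compat_l; auto).
  apply (Rmult_le_reg_r (99/100 * m)); [lra|].
  assert (m * (16 * k * e + 4 * E) = m * w) by (rewrite Ew; reflexivity).
  assert (0 <= m * w) by (apply Rmult_le_pos; lra).
  lra.
Qed.

(** The value [16 * k * e + 4 * E] of [ratio_recursion_contract] for [e = dev m x] and the error
    [E = 32 * b ^ 2 * dev2 m x] of [pbin_recursion]. *)
Definition ratio_error (b k m : R) (x : nat) : R :=
  16 * k * dev m x + 128 * b ^ 2 * dev2 m x.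

Lemma ratio_error_pred (b k m : R) (y : nat) :
  0 < m -> 0 <= k -> ratio_error b k m y <= 4 * ratio_error b k m (S y).
Proof.
  intros Hm Hk; unfold ratio_error.
  pose proof (dev_pred m y Hm); pose proof (dev2_pred m y Hm).
  pose proof (dev_pos m (S y) Hm).
  assert (k * dev m y <= k * (4 * dev m (S y))) by (apply Rmult_le_compat_l; lra).
  assert (b ^ 2 * dev2 m y <= b ^ 2 * (4 * dev2 m (S y)))
    by (apply Rmult_le_compat_l; [apply pow2_ge_0|lra]).
  lra.
Qed.

(** Induction on [x]: both quotients are 0 at [x = 0], and [ratio_recursion_contract] absorbs the
    factor 4 lost by [ratio_error] between neighbours. *)
Lemma ratio_compare (l l' : list R) (b k m : R) (x : nat) :
  b <= 1/100 -> small_list b l -> small_list b l' -> 0 < m ->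
  lsum (fun q => q) l = m -> lsum (fun q => q) l' = m ->
  0 <= k ->
  Rabs (lsum (fun q => q * q) l - lsum (fun q => q * q) l') <= k * m ->
  INR x <= 3 / 2 * m ->
  Rabs (shift (pbin l) x / pbin l x - shift (pbin l') x / pbin l' x)
    <= ratio_error b k m x.
Proof.
  intros Hb Hl Hl' Hm Em Em' Hk Hk2.
  assert (Hw : forall x, 0 <= ratio_error b k m x).
  { intros y; unfold ratio_error.
    pose proof (dev_pos m y Hm); pose proof (dev2_pos m y Hm).
    assert (0 <= k * dev m y) by (apply Rmult_le_pos; lra).
    assert (0 <= b ^ 2 * dev2 m y) by (apply Rmult_le_pos; [apply pow2_ge_0|lra]). lra. }
  induction x as [|y IH]; intros Hx.
  - simpl. unfold Rdiv; rewrite !Rmult_0_l, Rminus_0_r, Rabs_R0; auto.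
  - assert (Hy : INR y <= 3 / 2 * m) by (rewrite S_INR in Hx; lra).
    specialize (IH Hy).
    assert (G : forall t, small_list b t -> lsum (fun q => q) t = m ->
      0 <= shift (pbin t) (S y) / pbin t (S y) <= 2 /\
      0 <= shift (pbin t) y / pbin t y <= 2 /\
      Rabs (1 - shift (pbin t) y / pbin t y) <= 4 * dev m (S y) /\
      Rabs (INR (S y) - shift (pbin t) (S y) / pbin t (S y) *
        (m + lsum (fun q => q * q) t * (1 - shift (pbin t) y / pbin t y)))
        <= 32 * b ^ 2 * dev2 m (S y) * m).
    { intros t Ht E; pose proof Hm as Hm'; rewrite <- E in Hm', Hx, Hy.
      destruct (pbin_ratio t b (S y) Hb Ht Hm' Hx) as [P1 [P2 P3]].
      destruct (pbin_ratio t b y Hb Ht Hm' Hy) as [Q1 [Q2 Q3]].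
      destruct (diff_pbin_bound t b y Hb Ht Hm' Hy) as [D1 _].
      pose proof (pbin_recursion t b (S y) Hb Ht Hm' Hx) as Rec.
      cbv zeta in Rec, D1; rewrite E in Rec, D1.
      assert (A : forall u v, 0 < v -> 0 <= u <= 2 * v -> 0 <= u / v <= 2).
      { intros u v Hv Hu; split; [apply Rmult_le_pos; [lra|left; apply Rinv_0_lt_compat; auto]|].
        apply (Rmult_le_reg_r v); auto. unfold Rdiv; rewrite Rmult_assoc, Rinv_l by lra. lra. }
      split; [apply A; auto|]. split; [apply A; auto|]. split.
      - pose proof (dev_pred m y Hm).
        apply (Rmult_le_reg_r (pbin t y)); auto.
        rewrite <- (Rabs_pos_eq (pbin t y)) at 2 by lra. rewrite <- Rabs_mult.
        replace ((1 - shift (pbin t) y / pbin t y) * pbin t y) with (diff (pbin t) y)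
          by (unfold diff; field; lra).
        eapply Rle_trans; [apply D1|]. apply Rmult_le_compat_r; lra.
      (* This is [pbin_recursion] divided by [P(y + 1)], with [diff P y] written as
         [P(y) * (1 - P(y - 1) / P(y))]. *)
      - apply (Rmult_le_reg_r (pbin t (S y))); auto.
        rewrite <- (Rabs_pos_eq (pbin t (S y))) at 2 by lra. rewrite <- Rabs_mult.
        match goal with |- Rabs ?u <= _ => replace u with
          (INR (S y) * pbin t (S y) - m * shift (pbin t) (S y) -
           lsum (fun q : R => q * q) t * shift (diff (pbin t)) (S y)) end; [exact Rec|].
        cbn [shift]; unfold diff; field; lra. }
    destruct (G l Hl Em) as [T1 [T2 [T3 T4]]].
    destruct (G l' Hl' Em') as [T1' [T2' [T3' T4']]].
    pose proof (lsum_sq_bounds l b Hl) as B; rewrite Em in B.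
    pose proof (ratio_error_pred b k m y Hm Hk).
    pose proof (dev_pos m (S y) Hm).
    apply (ratio_recursion_contract _ _ (shift (pbin l) y / pbin l y)
             (shift (pbin l') y / pbin l' y) m (lsum (fun q => q * q) l)
             (lsum (fun q => q * q) l') b (32 * b ^ 2 * dev2 m (S y)) _
             (INR (S y)) k (dev m (S y))); auto; try lra.
    unfold ratio_error; ring.
Qed.

Lemma chain_le (f : nat -> R) (a : R) (x k : nat) :
  (forall z, (x <= z < x + k)%nat -> f (S z) <= exp a * f z) ->
  f (x + k)%nat <= exp (a * INR k) * f x.
Proof.
  induction k as [|k IH]; intros H.
  - rewrite Nat.add_0_r; simpl; rewrite Rmult_0_r, exp_0; lra.
  - rewrite Nat.add_succ_r.
    eapply Rle_trans; [apply H; lia|].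
    rewrite S_INR, Rmult_plus_distr_l, Rmult_1_r, (Rplus_comm _ a), exp_plus, Rmult_assoc.
    apply Rmult_le_compat_l; [left; apply exp_pos|]. apply IH; intros; apply H; lia.
Qed.

Lemma chain_ge (f : nat -> R) (a : R) (x k : nat) :
  (forall z, (x <= z < x + k)%nat -> f z <= exp a * f (S z)) ->
  f x <= exp (a * INR k) * f (x + k)%nat.
Proof.
  induction k as [|k IH]; intros H.
  - rewrite Nat.add_0_r; simpl; rewrite Rmult_0_r, exp_0; lra.
  - rewrite Nat.add_succ_r.
    eapply Rle_trans; [apply IH; intros; apply H; lia|].
    rewrite S_INR, Rmult_plus_distr_l, Rmult_1_r, exp_plus, Rmult_assoc.
    apply Rmult_le_compat_l; [left; apply exp_pos|]. apply H; lia.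
Qed.

(** Expectation under [pbin l], by conditioning on one summand after the other; no summation range
    has to be fixed. *)
Fixpoint expect (l : list R) (g : nat -> R) : R :=
  match l with
  | [] => g O
  | q :: t => q * expect t (fun x => g (S x)) + (1 - q) * expect t g
  end.

Lemma sum_shift (f g : nat -> R) (K : nat) :
  sum_f_R0 (fun x => shift f x * g x) (S K) = sum_f_R0 (fun x => f x * g (S x)) K.
Proof.
  rewrite decomp_sum by lia; simpl shift; simpl pred. rewrite Rmult_0_l, Rplus_0_l. reflexivity.
Qed.

Lemma sum_pbin (l : list R) (g : nat -> R) (K : nat) :
  (length l <= K)%nat -> sum_f_R0 (fun x => pbin l x * g x) K = expect l g.
Proof.
  revert g K; induction l as [|q t IH]; intros g K HK.
  - clear HK; simpl expect. induction K as [|K IHK]; simpl; [ring|].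
    simpl in IHK; rewrite IHK; ring.
  - simpl in HK; destruct K as [|K]; [lia|].
    simpl expect; rewrite <- (IH _ K), <- (IH _ (S K)) by lia.
    rewrite <- sum_shift, !scal_sum, <- sum_plus.
    apply sum_eq; intros i _; simpl; unfold conv; ring.
Qed.

Lemma expect_ext (l : list R) (g h : nat -> R) :
  (forall x, g x = h x) -> expect l g = expect l h.
Proof.
  revert g h; induction l as [|q t IH]; intros g h H; simpl; auto.
  rewrite (IH g h), (IH (fun x => g (S x)) (fun x => h (S x))); auto.
Qed.

Lemma expect_const (l : list R) (a : R) : expect l (fun _ => a) = a.
Proof. induction l as [|q t IH]; simpl; auto. rewrite IH; ring. Qed.

(** Variance plus squared bias. The centre [c] stays free because a success of the first variable
    moves it to [c - 1]. *)
Lemma expect_sq (l : list R) (c : R) :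
  expect l (fun x => (INR x - c) ^ 2) =
  lsum (fun q => q) l - lsum (fun q => q * q) l + (lsum (fun q => q) l - c) ^ 2.
Proof.
  revert c; induction l as [|q t IH]; intros c; cbn [expect].
  - simpl; ring.
  - rewrite (expect_ext t _ (fun x => (INR x - (c - 1)) ^ 2)) by (intros; rewrite S_INR; ring).
    rewrite !IH; simpl; ring.
Qed.

Lemma expect_pow (l : list R) (z : R) :
  expect l (fun x => z ^ x) = fold_right (fun q s => (1 + q * (z - 1)) * s) 1 l.
Proof.
  assert (H : forall a, expect l (fun x => a * z ^ x) =
              a * fold_right (fun q s => (1 + q * (z - 1)) * s) 1 l).
  { induction l as [|q t IH]; intros a; simpl; [reflexivity|].
    rewrite (expect_ext t _ (fun x => (a * z) * z ^ x)) by (intros; ring).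
    rewrite !IH; ring. }
  rewrite (expect_ext l _ (fun x => 1 * z ^ x)), H by (intros; ring). ring.
Qed.

(* The ratio of the two mass functions varies by at most a factor [exp (4 * W * D)] on
   the window of radius [D] around the mean; outside of it Chebyshev's inequality costs
   [m / L ^ 2]. Exchanging [l] and [l'] gives the opposite bound on the ratio. *)
Lemma pbin_compare (l l' : list R) (b k m D L W : R) (x : nat) :
  b <= 1/100 -> small_list b l -> small_list b l' -> 0 < m ->
  lsum (fun q => q) l = m -> lsum (fun q => q) l' = m ->
  0 <= k ->
  Rabs (lsum (fun q => q * q) l - lsum (fun q => q * q) l') <= k * m ->
  0 < L <= D -> (D + 1) / m <= 1/8 -> Rabs (m - INR x) <= D ->
  W = 16 * k * ((D + 1) / m) + 128 * b ^ 2 * (((D + 1) / m) ^ 2 + / m) ->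
  0 < pbin l x /\ 0 < pbin l' x /\
  1 <= exp (4 * W * D) * (pbin l x / pbin l' x) + m / L ^ 2.
Proof.
  intros Hb Hl Hl' Hm Em Em' Hk Hk2 [HL HLD] HD Hx EW.
  assert (HDm : D + 1 <= m / 8).
  { apply (Rmult_le_reg_r (/ m)); [apply Rinv_0_lt_compat; auto|].
    replace (m / 8 * / m) with (1/8) by (field; lra). exact HD. }
  set (win := fun z => Rabs (m - INR z) <= D).
  assert (Wx : forall z, win z -> INR z <= 3 / 2 * m).
  { intros z Hz; unfold win in Hz; apply Rabs_le_inv in Hz; lra. }
  assert (Wpos : forall t, small_list b t -> lsum (fun q => q) t = m ->
     forall z, win z -> 0 < pbin t z).
  { intros t Ht E z Hz; apply Wx in Hz; rewrite <- E in Hz, Hm.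
    destruct (pbin_ratio t b z Hb Ht Hm Hz); auto. }
  assert (Wdev : forall z, win z -> dev m z <= (D + 1) / m).
  { intros z Hz; unfold dev, Rdiv; apply Rmult_le_compat_r;
      [left; apply Rinv_0_lt_compat; auto|unfold win in Hz; lra]. }
  assert (Werr : forall z, win z -> ratio_error b k m z <= W).
  { intros z Hz; specialize (Wdev z Hz). pose proof (dev_pos m z Hm).
    rewrite EW; unfold ratio_error, dev2; apply Rplus_le_compat.
    - apply Rmult_le_compat_l; lra.
    - apply Rmult_le_compat_l; [pose proof (pow2_ge_0 b); lra|].
      apply Rplus_le_compat_r. apply pow_incr; lra. }
  assert (HW : 0 <= W).
  { eapply Rle_trans; [|apply (Werr x Hx)]; unfold ratio_error.
    pose proof (dev_pos m x Hm); pose proof (dev2_pos m x Hm).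
    assert (0 <= k * dev m x) by (apply Rmult_le_pos; lra).
    assert (0 <= b ^ 2 * dev2 m x) by (apply Rmult_le_pos; [apply pow2_ge_0|lra]). lra. }
  (* On the window [2 * dev <= 2 * 1/8], so one step back loses at most a quarter of the mass. *)
  assert (Wlow : forall t, small_list b t -> lsum (fun q => q) t = m ->
     forall z, win (S z) -> 3/4 * pbin t (S z) <= pbin t z).
  { intros t Ht E z Hz; pose proof (Wx _ Hz) as Hz1; pose proof (Wdev _ Hz) as Hz2.
    pose proof (Wpos t Ht E _ Hz) as HP.
    rewrite <- E in Hz1; assert (Hm' : 0 < lsum (fun q => q) t) by lra.
    destruct (diff_pbin_bound t b (S z) Hb Ht Hm' Hz1) as [D1 _].
    rewrite E in D1. unfold diff in D1; cbn [shift] in D1.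
    apply Rabs_le_inv in D1. nra. }
  (* The factor [4/3] is the price, by [Wlow], of turning the additive error [W] between quotients
     into a relative one. *)
  assert (Hexp : 1 + 4/3 * W <= exp (2 * W)).
  { pose proof (exp_ineq1_le (2 * W)); lra. }
  set (f := fun z => pbin l z / pbin l' z).
  assert (Hstep : forall z, win z -> win (S z) ->
     f (S z) <= exp (2 * W) * f z /\ f z <= exp (2 * W) * f (S z)).
  { intros z Hz Hz1.
    pose proof (ratio_compare l l' b k m (S z) Hb Hl Hl' Hm Em Em' Hk Hk2 (Wx _ Hz1)) as H.
    pose proof (Werr _ Hz1) as H1. cbn [shift] in H.
    pose proof (Wpos l Hl Em _ Hz) as P1; pose proof (Wpos l Hl Em _ Hz1) as P2.
    pose proof (Wpos l' Hl' Em' _ Hz) as Q1; pose proof (Wpos l' Hl' Em' _ Hz1) as Q2.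
    pose proof (Wlow l Hl Em _ Hz1) as P3; pose proof (Wlow l' Hl' Em' _ Hz1) as Q3.
    assert (PQ : 0 < pbin l (S z) * pbin l' (S z)) by (apply Rmult_lt_0_compat; auto).
    assert (H2 : Rabs (pbin l z / pbin l (S z) - pbin l' z / pbin l' (S z)) <= W) by lra.
    apply Rabs_le_inv in H2.
    assert (H3 : - (W * (pbin l (S z) * pbin l' (S z)))
       <= pbin l z * pbin l' (S z) - pbin l' z * pbin l (S z)
       <= W * (pbin l (S z) * pbin l' (S z))).
    { replace (pbin l z * pbin l' (S z) - pbin l' z * pbin l (S z)) with
        ((pbin l z / pbin l (S z) - pbin l' z / pbin l' (S z)) * (pbin l (S z) * pbin l' (S z)))
        by (field; lra). nra. }
    assert (A : forall u v v', 0 < u -> 0 <= v' -> 3/4 * v' <= v -> W * (u * v') <= 4/3 * W * (u * v)).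
    { intros u v v' Hu Hv' Hv. assert (u * v' <= u * (4/3 * v)) by (apply Rmult_le_compat_l; lra).
      assert (W * (u * v') <= W * (u * (4/3 * v))) by (apply Rmult_le_compat_l; lra). lra. }
    pose proof (A (pbin l (S z)) (pbin l' z) (pbin l' (S z)) P2 (Rlt_le _ _ Q2) Q3) as A1.
    pose proof (A (pbin l' (S z)) (pbin l z) (pbin l (S z)) Q2 (Rlt_le _ _ P2) P3) as A2.
    assert (B : forall u v u' v', 0 < u -> 0 < v -> 0 < u' -> 0 < v' ->
       u * v' <= (1 + 4/3 * W) * (u' * v) -> u / v <= exp (2 * W) * (u' / v')).
    { intros u v u' v' Hu Hv Hu' Hv' HH.
      apply (Rmult_le_reg_r (v * v')); [apply Rmult_lt_0_compat; auto|].
      replace (u / v * (v * v')) with (u * v') by (field; lra).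
      replace (exp (2 * W) * (u' / v') * (v * v')) with (exp (2 * W) * (u' * v)) by (field; lra).
      eapply Rle_trans; [exact HH|]. apply Rmult_le_compat_r; auto.
      left; apply Rmult_lt_0_compat; auto. }
    unfold f; split; apply B; auto; lra. }
  assert (Hconv : forall y z u, win y -> win z -> (y <= u <= z)%nat -> win u).
  { intros y z u Hy Hz [Hu1 Hu2]; unfold win in *.
    apply le_INR in Hu1; apply le_INR in Hu2.
    apply Rabs_le_inv in Hy; apply Rabs_le_inv in Hz; apply Rabs_le; lra. }
  (* Two points of the window are at most [2 * D] steps apart, and each step costs [exp (2 * W)]. *)
  assert (Hfar : forall y j : nat, win y -> win (y + j)%nat -> exp (2 * W * INR j) <= exp (4 * W * D)).
  { intros y j Hy Hyj. assert (INR j <= 2 * D).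
    { unfold win in *; rewrite plus_INR in Hyj.
      apply Rabs_le_inv in Hy; apply Rabs_le_inv in Hyj; lra. }
    assert (2 * W * INR j <= 4 * W * D) by nra.
    destruct (Rle_lt_or_eq_dec _ _ H0) as [Hlt|Heq]; [left; apply exp_increasing; auto|rewrite Heq; lra]. }
  assert (Hf : forall y, win y -> f y <= exp (4 * W * D) * f x).
  { intros y Hy.
    assert (f0 : 0 < f x).
    { unfold f; apply Rdiv_lt_0_compat; [apply (Wpos l)|apply (Wpos l')]; auto. }
    destruct (le_ge_dec x y) as [Hxy|Hxy].
    - replace y with (x + (y - x))%nat in * by lia.
      eapply Rle_trans; [apply (chain_le f (2 * W))|].
      + intros z Hz; apply Hstep; apply (Hconv x (x + (y - x))%nat); auto; lia.
      + apply Rmult_le_compat_r; [lra|]. apply (Hfar x); auto.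
    - replace x with (y + (x - y))%nat in * by lia.
      eapply Rle_trans; [apply (chain_ge f (2 * W) y (x - y))|].
      + intros z Hz; apply Hstep; apply (Hconv y (y + (x - y))%nat); auto; lia.
      + apply Rmult_le_compat_r; [lra|]. apply (Hfar y); auto. }
  split; [apply (Wpos l); auto|]. split; [apply (Wpos l'); auto|].
  assert (Hl1 : forall t, small_list b t -> forall y, 0 <= pbin t y).
  { intros t Ht; apply pbin_nonneg; intros q Hq; specialize (Ht q Hq); lra. }
  (* A summation range covering the supports of both laws. *)
  set (K := (length l + length l')%nat).
  assert (S1 : sum_f_R0 (fun y => pbin l y * 1) K = 1)
    by (rewrite sum_pbin by (unfold K; lia); apply expect_const).
  rewrite <- S1 at 1.
  replace (exp (4 * W * D) * (pbin l x / pbin l' x)) with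
    (expect l' (fun _ => exp (4 * W * D) * f x)) by (apply expect_const).
  assert (HL2 : 0 < / L ^ 2) by (apply Rinv_0_lt_compat; nra).
  (* Pointwise bound on [pbin l y]: inside the window [Hf] gives the first term; outside it
     [L <= D < |y - m|], so the factor [(y - m)^2 / L^2] is at least 1. *)
  apply Rle_trans with (expect l' (fun _ => exp (4 * W * D) * f x)
     + / L ^ 2 * expect l (fun y => (INR y - m) ^ 2)).
  - rewrite <- (sum_pbin l' _ K), <- (sum_pbin l _ K) by (unfold K; lia).
    rewrite scal_sum, <- sum_plus. apply sum_Rle; intros y _.
    pose proof (Hl1 l Hl y) as Py; pose proof (Hl1 l' Hl' y) as Qy.
    destruct (Rle_dec (Rabs (m - INR y)) D) as [Hy|Hy].
    + pose proof (Hf y Hy) as H; unfold f at 1 in H.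
      pose proof (Wpos l' Hl' Em' _ Hy) as Q1.
      assert (pbin l y <= exp (4 * W * D) * f x * pbin l' y).
      { apply (Rmult_le_compat_r (pbin l' y)) in H; [|lra].
        replace (pbin l y / pbin l' y * pbin l' y) with (pbin l y) in H by (field; lra). lra. }
      assert (0 <= pbin l y * (INR y - m) ^ 2 * / L ^ 2).
      { apply Rmult_le_pos; [|lra]. apply Rmult_le_pos; auto. apply pow2_ge_0. }
      lra.
    + assert (0 <= pbin l' y * (exp (4 * W * D) * f x)).
      { apply Rmult_le_pos; auto. apply Rmult_le_pos; [left; apply exp_pos|].
        unfold f; left; apply Rdiv_lt_0_compat; [apply (Wpos l)|apply (Wpos l')]; auto. }
      assert (L ^ 2 <= (INR y - m) ^ 2).
      { rewrite <- (pow2_abs (INR y - m)), Rabs_minus_sym. apply pow_incr; lra. }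
      assert (pbin l y * (INR y - m) ^ 2 * / L ^ 2 >= pbin l y * L ^ 2 * / L ^ 2).
      { apply Rle_ge, Rmult_le_compat_r; [lra|]. apply Rmult_le_compat_l; auto. }
      rewrite (Rmult_assoc _ (L ^ 2)), Rinv_r in H1 by nra. lra.
  - apply Rplus_le_compat_l. rewrite expect_sq, Em.
    unfold Rdiv; rewrite (Rmult_comm m). apply Rmult_le_compat_l; [lra|].
    pose proof (lsum_sq_bounds l b Hl). replace ((m - m) ^ 2) with 0 by ring. lra.
Qed.

(** * The number of runs is Poisson-binomial *)

(** Pascal's rule is the recursion [conv]; the boundary [k = N], where it does not apply, is treated
    apart. *)
Lemma BI_pbin (N : nat) (q : R) (k : nat) : BI N q k = pbin (repeat q N) k.
Proof.
  revert k; induction N as [|N IH]; intros k.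
  - destruct k as [|k]; unfold BI; simpl; [|reflexivity].
    unfold C; simpl; field.
  - simpl; unfold conv; rewrite <- IH.
    assert (C0 : forall n, C n 0 = 1).
    { intros n; unfold C; rewrite Nat.sub_0_r; simpl; field; apply INR_fact_neq_0. }
    assert (Cn : forall n, C n n = 1).
    { intros n; unfold C; rewrite Nat.sub_diag; simpl; field; apply INR_fact_neq_0. }
    destruct k as [|k]; simpl shift.
    + unfold BI; simpl Nat.leb; cbv iota. rewrite !C0, !Nat.sub_0_r; simpl; ring.
    + rewrite <- IH; unfold BI.
      destruct (Nat.leb_spec (S k) (S N)); destruct (Nat.leb_spec (S k) N);
        destruct (Nat.leb_spec k N); try lia; try ring.
      * rewrite <- pascal by lia.
        replace (S N - S k)%nat with (S (N - S k)) by lia.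
        replace (N - k)%nat with (S (N - S k)) by lia. simpl; ring.
      * replace k with N by lia. rewrite !Cn, !Nat.sub_diag; simpl; ring.
Qed.

(** Fibonacci polynomials, indexed so that [m] is the number of bits: both initial values are 1, as
    fewer than two bits contain no run end. *)
Fixpoint fib (w : R) (m : nat) : R :=
  match m with
  | O => 1
  | S m' => match m' with O => 1 | S m'' => fib w m' + w * fib w m'' end
  end.

Lemma fib_SS (w : R) (m : nat) : fib w (S (S m)) = fib w (S m) + w * fib w m.
Proof. reflexivity. Qed.

Lemma nat_pair_ind (Q : nat -> Prop) :
  Q 0%nat -> Q 1%nat -> (forall m, Q m -> Q (S m) -> Q (S (S m))) -> forall m, Q m.
Proof.
  intros H0 H1 HS m; enough (Q m /\ Q (S m)) by tauto.
  induction m as [|m [IH1 IH2]]; auto.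
Qed.

Definition run_gf (p z : R) (m : nat) : R :=
  lsum (fun s => bern_weight p s * z ^ S_stat s) (all_bits m).

(* Conditioning on the first bit gives a linear recursion for [run_gf] and for the same
   sum with a one prepended; eliminating the latter leaves the recursion of [fib]. *)
Lemma run_gf_fib (p z : R) (m : nat) : run_gf p z m = fib (alpha p * (z - 1)) m.
Proof.
  set (h := fun m => lsum (fun s => bern_weight p s * z ^ S_stat (true :: s)) (all_bits m)).
  assert (G : forall m, run_gf p z (S m) = p * h m + (1 - p) * run_gf p z m).
  { intros k; unfold run_gf, h; simpl all_bits. rewrite lsum_app, !lsum_map, <- !lsum_scal.
    f_equal; apply lsum_ext; intros s _; simpl; ring. }
  assert (H : forall m, h (S m) = p * h m + (1 - p) * z * run_gf p z m).
  { intros k; unfold run_gf, h; simpl all_bits. rewrite lsum_app, !lsum_map, <- !lsum_scal.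
    f_equal; apply lsum_ext; intros s _; simpl; ring. }
  induction m as [| |m IH1 IH2] using nat_pair_ind.
  - unfold run_gf; simpl; ring.
  - rewrite G; unfold run_gf, h; simpl; ring.
  - rewrite fib_SS, <- IH1, <- IH2, (G (S m)), H, (G m); unfold alpha; ring.
Qed.

Lemma S_stat_le (s : list bool) : (S_stat s <= length s)%nat.
Proof.
  (* [S_stat] looks one bit ahead, so the induction also carries the list with a one prepended. *)
  enough (H : (S_stat s <= length s /\ S_stat (true :: s) <= S (length s))%nat) by tauto.
  induction s as [|b s [IH1 IH2]]; [simpl; lia|].
  split; destruct b; simpl in *; lia.
Qed.

Lemma all_bits_length (m : nat) (s : list bool) : In s (all_bits m) -> length s = m.
Proof.
  revert s; induction m as [|m IH]; simpl; intros s.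
  - intros [<-|[]]; reflexivity.
  - rewrite in_app_iff, !in_map_iff.
    intros [[t [<- Ht]]|[t [<- Ht]]]; simpl; rewrite IH; auto.
Qed.

Lemma sum_delta (a : R) (g : nat -> R) (j K : nat) :
  (j <= K)%nat -> sum_f_R0 (fun x => (if Nat.eqb j x then a else 0) * g x) K = a * g j.
Proof.
  induction K as [|K IH]; intros H.
  - replace j with 0%nat by lia; simpl; ring.
  - simpl sum_f_R0. destruct (Nat.eq_dec j (S K)) as [->|Hj].
    + rewrite Nat.eqb_refl, (sum_eq _ (fun _ => 0)), sum_eq_R0; auto; [ring|].
      intros i Hi; destruct (Nat.eqb_spec (S K) i); [lia|ring].
    + rewrite IH by lia. destruct (Nat.eqb_spec j (S K)); [lia|ring].
Qed.

(** Exchanging the sums leaves one term [z ^ S_stat s] per bit string; [K] exceeds every value of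
    the statistic. *)
Lemma sum_prob_S (n K : nat) (p z : R) :
  (S n <= K)%nat ->
  sum_f_R0 (fun x => prob_S n p x * z ^ x) K = fib (alpha p * (z - 1)) (S n).
Proof.
  intros HK; rewrite <- run_gf_fib; unfold run_gf, prob_S.
  assert (H : forall s, In s (all_bits (S n)) -> (S_stat s <= K)%nat).
  { intros s Hs; apply all_bits_length in Hs; pose proof (S_stat_le s); lia. }
  revert H; generalize (all_bits (S n)); induction l as [|s l IH]; intros H; simpl.
  - rewrite (sum_eq _ (fun _ => 0)), sum_eq_R0; auto; intros; ring.
  - rewrite <- IH by (intros; apply H; right; auto).
    rewrite <- (sum_delta _ (fun x => z ^ x) _ K) by (apply H; left; auto).
    rewrite <- sum_plus; apply sum_eq; intros i _; ring.
Qed.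

(** * Polynomial functions and the uniqueness of their coefficients *)

(** Polynomial functions of degree at most [h], in Horner form and up to pointwise equality. *)
Fixpoint polyfun (h : nat) (f : R -> R) : Prop :=
  match h with
  | O => exists a, forall w, f w = a
  | S h' => exists a g, polyfun h' g /\ forall w, f w = a + w * g w
  end.

Lemma polyfun_S (h : nat) (f : R -> R) : polyfun h f -> polyfun (S h) f.
Proof.
  revert f; induction h as [|h IH]; intros f.
  - intros [a Ha]; exists a, (fun _ => 0); split; [exists 0; auto|intros; rewrite Ha; ring].
  - intros [a [g [Hg Hf]]]; exists a, g; split; auto.
Qed.

Lemma polyfun_mono (h k : nat) (f : R -> R) : (h <= k)%nat -> polyfun h f -> polyfun k f.
Proof. induction 1; auto; intros; apply polyfun_S; auto. Qed.

Lemma polyfun_lin (h : nat) (f g : R -> R) (a b : R) :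
  polyfun h f -> polyfun h g -> polyfun h (fun w => a * f w + b * g w).
Proof.
  revert f g; induction h as [|h IH]; intros f g.
  - intros [u Hu] [v Hv]; exists (a * u + b * v); intros; rewrite Hu, Hv; ring.
  - intros [u [f' [Hf' Hf]]] [v [g' [Hg' Hg]]].
    exists (a * u + b * v), (fun w => a * f' w + b * g' w); split; [apply IH; auto|].
    intros w; rewrite Hf, Hg; ring.
Qed.

Lemma polyfun_mulX (h : nat) (f : R -> R) :
  polyfun h f -> polyfun (S h) (fun w => w * f w).
Proof. intros H; exists 0, f; split; auto; intros; ring. Qed.

Lemma polyfun_ext (h : nat) (f g : R -> R) :
  (forall w, f w = g w) -> polyfun h f -> polyfun h g.
Proof.
  intros E; destruct h as [|h].
  - intros [a Ha]; exists a; intros; rewrite <- E; auto.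
  - intros [a [k [Hk Hf]]]; exists a, k; split; auto; intros; rewrite <- E; auto.
Qed.

(** Synthetic division by [w - r]: if [f w = a + w * g w] and [g w = g r + (w - r) * g' w], the
    quotient is [g r + w * g' w]. *)
Lemma polyfun_factor (h : nat) (f : R -> R) (r : R) :
  polyfun (S h) f ->
  exists g, polyfun h g /\ forall w, f w = f r + (w - r) * g w.
Proof.
  revert f; induction h as [|h IH]; intros f [a [g [Hg Hf]]].
  - destruct Hg as [b Hb]; exists (fun _ => b); split; [exists b; auto|].
    intros w; rewrite (Hf w), (Hf r), !Hb; ring.
  - destruct (IH g Hg) as [g' [Hg' E]].
    exists (fun w => g r + w * g' w); split.
    + exists (g r), g'; auto.
    + intros w; rewrite (Hf w), (Hf r), (E w); ring.
Qed.

Lemma polyfun_roots (h : nat) (f : R -> R) (rs : list R) :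
  polyfun h f -> NoDup rs -> length rs = S h ->
  (forall r, In r rs -> f r = 0) -> forall w, f w = 0.
Proof.
  revert f rs; induction h as [|h IH]; intros f rs Hf Hrs Hlen Hz w.
  - destruct Hf as [a Ha]; destruct rs as [|r rs]; [discriminate|].
    rewrite Ha, <- (Ha r); apply Hz; left; auto.
  - destruct rs as [|r rs]; [discriminate|].
    destruct (polyfun_factor h f r Hf) as [g [Hg E]].
    inversion Hrs as [|? ? Hr Hrs']; subst.
    assert (Hfr : f r = 0) by (apply Hz; left; auto).
    rewrite E, Hfr, (IH g rs Hg Hrs'); [ring|simpl in Hlen; lia|].
    intros s Hs. assert (f s = 0) by (apply Hz; right; auto).
    rewrite E, Hfr in H. assert (s <> r) by (intros ->; auto).
    apply (Rmult_eq_reg_l (s - r)); lra.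
Qed.

Lemma NoDup_map_in {A B : Type} (f : A -> B) (l : list A) :
  (forall a b, In a l -> In b l -> f a = f b -> a = b) -> NoDup l -> NoDup (map f l).
Proof.
  induction l as [|a l IH]; intros H Hl; simpl; [constructor|].
  inversion Hl; subst; constructor.
  - rewrite in_map_iff; intros [b [E Hb]].
    assert (b = a) by (apply H; simpl; auto). subst; auto.
  - apply IH; auto; intros; apply H; simpl; auto.
Qed.

(** Evaluation at 0 kills [a]. Then [g] vanishes at [h + 1] positive integers, hence everywhere,
    including at 0 where [w * g w = 0] says nothing. *)
Lemma polyfun_tail_zero (h : nat) (a : R) (g : R -> R) :
  polyfun h g -> (forall w, a + w * g w = 0) -> a = 0 /\ forall w, g w = 0.
Proof.
  intros Hg H; assert (Ha : a = 0) by (specialize (H 0); lra).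
  split; auto. apply (polyfun_roots h g (map INR (seq 1 (S h)))); auto.
  - apply NoDup_map_in; [intros; apply INR_eq; auto|apply seq_NoDup].
  - rewrite length_map, length_seq; auto.
  - intros r Hr; apply in_map_iff in Hr; destruct Hr as [k [<- Hk]].
    apply in_seq in Hk. specialize (H (INR k)).
    assert (0 < INR k) by (apply lt_0_INR; lia).
    apply (Rmult_eq_reg_l (INR k)); lra.
Qed.

Lemma power_series_zero (a : nat -> R) (K : nat) :
  (forall z, sum_f_R0 (fun x => a x * z ^ x) K = 0) ->
  forall x, (x <= K)%nat -> a x = 0.
Proof.
  assert (P : forall K a, polyfun K (fun z => sum_f_R0 (fun x => a x * z ^ x) K)).
  { clear; induction K as [|K IH]; intros a.
    - exists (a 0%nat); intros; simpl; ring.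
    - exists (a 0%nat), (fun z => sum_f_R0 (fun x => a (S x) * z ^ x) K); split; [apply (IH (fun x => a (S x)))|].
      intros w; rewrite decomp_sum, scal_sum by lia; simpl pred.
      f_equal; [simpl; ring|apply sum_eq; intros; simpl; ring]. }
  revert a; induction K as [|K IH]; intros a H x Hx.
  - replace x with 0%nat by lia; specialize (H 0); simpl in H; lra.
  - destruct (polyfun_tail_zero K (a 0%nat) _ (P K (fun x => a (S x)))) as [H0 H1].
    + intros w; rewrite <- (H w), (decomp_sum _ (S K)), scal_sum by lia; simpl pred.
      f_equal; [simpl; ring|apply sum_eq; intros; simpl; ring].
    + destruct x as [|x]; auto. apply (IH (fun x => a (S x))); auto; lia.
Qed.

(** * Factorization of the Fibonacci polynomials *)

(** The degree rises by one every two indices. The bound has to be this sharp: [fib_linprod]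
    supplies only one more zero than the degree. *)
Lemma polyfun_fib (m : nat) : polyfun (Nat.div2 m) (fun w => fib w m).
Proof.
  induction m as [| |m IH1 IH2] using nat_pair_ind; try (exists 1; reflexivity).
  apply (polyfun_ext _ (fun w => 1 * fib w (S m) + 1 * (w * fib w m))).
  - intros; rewrite fib_SS; ring.
  - apply polyfun_lin; [|apply polyfun_mulX; auto].
    apply (polyfun_mono (Nat.div2 (S m))); auto.
    change (Nat.div2 (S (S m))) with (S (Nat.div2 m)).
    pose proof (Nat.div2_odd m) as E1; pose proof (Nat.div2_odd (S m)) as E2.
    destruct (Nat.odd m), (Nat.odd (S m)); cbn [Nat.b2n] in E1, E2; lia.
Qed.

Definition linprod (l : list R) (w : R) : R :=
  fold_right (fun c s => (1 + c * w) * s) 1 l.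

Lemma polyfun_linprod (l : list R) : polyfun (length l) (linprod l).
Proof.
  induction l as [|c l IH]; [exists 1; reflexivity|].
  apply (polyfun_ext _ (fun w => 1 * linprod l w + c * (w * linprod l w))).
  - intros; unfold linprod; simpl; ring.
  - apply polyfun_lin; [apply polyfun_S; auto|apply polyfun_mulX; auto].
Qed.

(** Chebyshev polynomials of the second kind: [U_m (cos t) = (2 cos t)^m F_m (-1 / (4 cos^2 t))],
    and [U_m (cos t) * sin t = sin ((m + 1) t)]. Both sides obey the same two-term recursion. *)
Lemma fib_sin (t : R) (m : nat) :
  cos t <> 0 ->
  fib (- / (4 * cos t ^ 2)) m * (2 * cos t) ^ m * sin t = sin (INR (S m) * t).
Proof.
  intros Hc; induction m as [| |m IH1 IH2] using nat_pair_ind.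
  - simpl; rewrite !Rmult_1_l; ring.
  - replace (INR 2 * t) with (2 * t) by (simpl; ring). rewrite sin_2a; simpl; ring.
  - rewrite fib_SS.
    assert (E : sin (INR (S (S (S m))) * t)
                = 2 * cos t * sin (INR (S (S m)) * t) - sin (INR (S m) * t)).
    { replace (INR (S (S (S m))) * t) with (INR (S (S m)) * t + t) by (rewrite (S_INR (S (S m))); ring).
      replace (INR (S m) * t) with (INR (S (S m)) * t - t) by (rewrite (S_INR (S m)); ring).
      rewrite sin_plus, sin_minus; ring. }
    rewrite E, <- IH1, <- IH2; simpl; field; auto.
Qed.

Definition angle (n j : nat) : R := INR j * PI / INR (n + 2).

Lemma angle_range (n j : nat) :
  (1 <= j <= Nat.div2 (S n))%nat -> 0 < angle n j < PI / 2.
Proof.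
  intros [H1 H2]. assert (H3 : (2 * j < n + 2)%nat).
  { pose proof (Nat.div2_odd (S n)). destruct (Nat.odd (S n)); simpl Nat.b2n in H; lia. }
  apply lt_INR in H3; rewrite mult_INR in H3; simpl (INR 2) in H3.
  assert (0 < INR j) by (apply lt_0_INR; lia). pose proof PI_RGT_0.
  unfold angle; split.
  - apply Rdiv_lt_0_compat; [apply Rmult_lt_0_compat; auto|lra].
  - apply (Rmult_lt_reg_r (INR (n + 2))); [lra|].
    unfold Rdiv at 1; rewrite Rmult_assoc, Rinv_l by lra. nra.
Qed.

Definition cos_weight (n j : nat) : R := 4 * cos (angle n j) ^ 2.

Definition cos_weights (n : nat) : list R :=
  map (cos_weight n) (seq 1 (Nat.div2 (S n))).

Lemma fib_linprod (n : nat) (w : R) : fib w (S n) = linprod (cos_weights n) w.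
Proof.
  set (h := Nat.div2 (S n)).
  assert (Hc : forall j, In j (seq 1 h) -> 0 < cos (angle n j) /\ 0 < angle n j < PI / 2).
  { intros j Hj; apply in_seq in Hj. assert (H := angle_range n j).
    split; [|apply H; unfold h in Hj; lia]. apply cos_gt_0; destruct H; unfold h in Hj; try lia; lra. }
  enough (E : forall v, 1 * fib v (S n) + (-1) * linprod (cos_weights n) v = 0)
    by (specialize (E w); lra).
  set (root := fun j => - / cos_weight n j).
  (* Both polynomials vanish at the [h] points [root j] and equal 1 at 0, so their difference, of
     degree at most [h], has [h + 1] zeros. *)
  apply (polyfun_roots h _ (0 :: map root (seq 1 h))).
  - apply polyfun_lin; [apply polyfun_fib|].
    replace h with (length (cos_weights n)) by (unfold cos_weights; rewrite length_map, length_seq; reflexivity).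
    apply polyfun_linprod.
  - constructor.
    + rewrite in_map_iff; intros [j [E Hj]]. destruct (Hc j Hj) as [H _].
      assert (0 < cos_weight n j) by (unfold cos_weight; nra).
      pose proof (Rinv_0_lt_compat _ H0). unfold root in E; lra.
    + apply NoDup_map_in; [|apply seq_NoDup].
      intros i j Hi Hj E. destruct (Hc i Hi) as [H1 H2], (Hc j Hj) as [H3 H4].
      unfold root in E; apply Ropp_eq_compat in E; rewrite !Ropp_involutive in E.
      apply Rinv_eq_reg in E; unfold cos_weight in E.
      assert (E1 : cos (angle n i) = cos (angle n j)) by nra.
      assert (E2 : angle n i = angle n j).
      { pose proof PI_RGT_0. destruct (Rtotal_order (angle n i) (angle n j)) as [G|[G|G]]; auto;
          apply cos_decreasing_1 in G; lra. }
      unfold angle in E2. apply INR_eq.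
      assert (0 < INR (n + 2)) by (apply lt_0_INR; lia). pose proof PI_RGT_0.
      apply (Rmult_eq_reg_r (PI / INR (n + 2))); [unfold Rdiv in *; lra|].
      apply Rgt_not_eq, Rdiv_lt_0_compat; lra.
  - simpl; rewrite length_map, length_seq; reflexivity.
  - intros r [<-|Hr].
    + assert (F0 : forall m, fib 0 m = 1).
      { intros m; induction m as [| |m IH1 IH2] using nat_pair_ind; auto.
        rewrite fib_SS, IH2; ring. }
      assert (L0 : forall l, linprod l 0 = 1).
      { induction l as [|c l IH]; unfold linprod in *; simpl; auto. rewrite IH; ring. }
      rewrite F0, L0; ring.
    + apply in_map_iff in Hr; destruct Hr as [j [<- Hj]].
      destruct (Hc j Hj) as [H1 H2].
      assert (0 < cos_weight n j) by (unfold cos_weight; nra).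
      replace (linprod _ _) with 0.
      (* By [fib_sin] this product is the sine of [(n + 2) * angle n j = j * PI], while its last two
         factors are positive. *)
      * assert (F : fib (root j) (S n) * (2 * cos (angle n j)) ^ (S n) * sin (angle n j) = 0).
        { unfold root, cos_weight; rewrite fib_sin by lra.
          apply sin_eq_0_1. exists (Z.of_nat j). rewrite <- INR_IZR_INZ.
          unfold angle. replace (S (S n)) with (n + 2)%nat by lia.
          field. apply not_0_INR; lia. }
        assert (0 < sin (angle n j)) by (apply sin_gt_0; pose proof PI_RGT_0; lra).
        assert (0 < (2 * cos (angle n j)) ^ S n) by (apply pow_lt; lra).
        apply Rmult_integral in F; destruct F as [F|F]; [|lra].
        apply Rmult_integral in F; destruct F as [F|F]; lra.
      * unfold cos_weights; fold h. revert Hj; generalize (seq 1 h).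
        induction l as [|i l IH]; simpl; [tauto|]. intros [->|Hj].
        -- unfold root; unfold linprod; simpl.
           replace (1 + cos_weight n j * - / cos_weight n j) with 0 by (field; lra). ring.
        -- unfold linprod in *; simpl; rewrite <- IH; auto; ring.
Qed.

(** For [n = 0] the formula for the second coefficient would give 1 instead of 0, so the induction
    starts at [n = 1]. *)
Lemma fib_expansion (n : nat) :
  (1 <= n)%nat ->
  exists h g, polyfun h g /\ forall w, fib w (S n) =
    1 + w * (INR n + w * ((INR n - 1) * (INR n - 2) / 2 + w * g w)).
Proof.
  destruct n as [|n]; [lia|intros _].
  induction n as [| |n IH1 IH2] using nat_pair_ind.
  - exists O, (fun _ => 0); split; [exists 0; auto|intros; simpl; field].
  - exists O, (fun _ => 0); split; [exists 0; auto|intros; simpl; field].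
  - destruct IH1 as [h1 [g1 [Hg1 E1]]], IH2 as [h2 [g2 [Hg2 E2]]].
    exists (S (h1 + h2)), (fun w => 1 * ((INR (S n) - 1) * (INR (S n) - 2) / 2 + w * g1 w) + 1 * g2 w).
    split.
    + apply polyfun_lin; [|apply (polyfun_mono h2); auto; lia].
      eexists _, g1; split; [apply (polyfun_mono h1); auto; lia|reflexivity].
    + intros w; rewrite fib_SS, E1, E2, !S_INR; field.
Qed.

(** The second elementary symmetric function, written through power sums by Newton's identity. *)
Lemma linprod_expansion (l : list R) :
  exists h g, polyfun h g /\ forall w, linprod l w =
    1 + w * (lsum (fun c => c) l
      + w * ((lsum (fun c => c) l ^ 2 - lsum (fun c => c * c) l) / 2 + w * g w)).
Proof.
  induction l as [|c l [h [g [Hg E]]]].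
  - exists O, (fun _ => 0); split; [exists 0; auto|intros; unfold linprod; simpl; field].
  - set (e := (lsum (fun c => c) l ^ 2 - lsum (fun c => c * c) l) / 2) in *.
    exists (S h), (fun w => c * (e + w * g w) + 1 * g w); split.
    + apply polyfun_lin; [exists e, g; auto|apply polyfun_S; auto].
    + intros w; unfold linprod in *; simpl; rewrite E; unfold e; field.
Qed.

(* The power sums are read off the first coefficients of [fib_linprod]. *)
Lemma cos_weights_sums (n : nat) :
  (1 <= n)%nat ->
  lsum (fun c => c) (cos_weights n) = INR n /\
  lsum (fun c => c * c) (cos_weights n) = 3 * INR n - 2.
Proof.
  intros Hn; destruct (fib_expansion n Hn) as [h1 [g1 [Hg1 E1]]].
  destruct (linprod_expansion (cos_weights n)) as [h2 [g2 [Hg2 E2]]].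
  set (e := lsum (fun c => c) (cos_weights n)) in *.
  set (e2 := (e ^ 2 - lsum (fun c => c * c) (cos_weights n)) / 2) in *.
  set (f2 := (INR n - 1) * (INR n - 2) / 2) in *.
  set (h := (h1 + h2)%nat).
  assert (P0 : polyfun h (fun w => 1 * g1 w + (-1) * g2 w)).
  { apply polyfun_lin; [apply (polyfun_mono h1)|apply (polyfun_mono h2)]; auto; unfold h; lia. }
  assert (P1 : polyfun (S h) (fun w => (f2 - e2) + w * (1 * g1 w + (-1) * g2 w)))
    by (eexists _, _; split; [exact P0|reflexivity]).
  assert (P2 : polyfun (S (S h)) (fun w => (INR n - e) +
            w * ((f2 - e2) + w * (1 * g1 w + (-1) * g2 w))))
    by (eexists _, _; split; [exact P1|reflexivity]).
  destruct (polyfun_tail_zero _ 0 _ P2) as [_ Z2].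
  { intros w; pose proof (fib_linprod n w) as F; rewrite E1, E2 in F; lra. }
  destruct (polyfun_tail_zero _ _ _ P1 Z2) as [Y1 Z1].
  destruct (polyfun_tail_zero _ _ _ P0 Z1) as [Y0 _].
  assert (e = INR n) by lra. split; auto.
  unfold f2, e2 in Y0; rewrite H in Y0.
  set (u := lsum (fun c => c * c) (cos_weights n)) in *. nra.
Qed.

Definition run_list (n : nat) (p : R) : list R := map (Rmult (alpha p)) (cos_weights n).

Lemma prob_S_pbin (n : nat) (p : R) (x : nat) : prob_S n p x = pbin (run_list n p) x.
Proof.
  (* Large enough for both generating functions and for the coefficient of index [x]. *)
  set (K := (S n + length (run_list n p) + x)%nat).
  enough (E : prob_S n p x - pbin (run_list n p) x = 0) by lra.
  apply (power_series_zero (fun x => prob_S n p x - pbin (run_list n p) x) K);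
    [|unfold K; lia].
  intros z.
  rewrite (sum_eq _ (fun x => prob_S n p x * z ^ x - pbin (run_list n p) x * z ^ x))
    by (intros; ring).
  rewrite minus_sum, sum_prob_S, (sum_pbin _ (fun x => z ^ x)), expect_pow, fib_linprod
    by (unfold K; lia).
  unfold run_list; induction (cos_weights n) as [|c l IH]; unfold linprod in *; simpl; [ring|].
  apply Rminus_diag_uniq in IH; rewrite IH; ring.
Qed.

Lemma run_list_sums (n : nat) (p : R) :
  (1 <= n)%nat ->
  lsum (fun q => q) (run_list n p) = INR n * alpha p /\
  lsum (fun q => q * q) (run_list n p) = (3 * INR n - 2) * alpha p ^ 2.
Proof.
  intros Hn; destruct (cos_weights_sums n Hn) as [H1 H2].
  unfold run_list; rewrite !lsum_map, lsum_scal, H1; split; [ring|].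
  rewrite (lsum_ext _ (fun c => alpha p ^ 2 * (c * c))), lsum_scal, H2 by (intros; ring). ring.
Qed.

Lemma run_list_small (n : nat) (p : R) : 0 <= alpha p -> small_list (4 * alpha p) (run_list n p).
Proof.
  intros Ha q Hq; unfold run_list, cos_weights in Hq; rewrite map_map in Hq.
  apply in_map_iff in Hq; destruct Hq as [j [<- _]]; unfold cos_weight.
  pose proof (COS_bound (angle n j)). assert (0 <= cos (angle n j) ^ 2 <= 1) by nra. nra.
Qed.

Lemma repeat_sums (q : R) (N : nat) :
  lsum (fun q => q) (repeat q N) = INR N * q /\
  lsum (fun q => q * q) (repeat q N) = INR N * q ^ 2.
Proof.
  induction N as [|N [IH1 IH2]]; [simpl; lra|].
  cbn [repeat lsum fold_right]; unfold lsum in *; rewrite IH1, IH2, S_INR; split; ring.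
Qed.

(** * The asymptotics *)

(** The second line is the rounding error of the floor, multiplied by [3 n - 2]. From [n >= 12] on,
    [n / 3 - 1 >= n / 4]. *)
Lemma Nfl_bounds (n : nat) :
  (12 <= n)%nat ->
  INR n / 4 <= INR (Nfl n) /\
  0 <= INR n ^ 2 - INR (Nfl n) * (3 * INR n - 2) <= 3 * INR n.
Proof.
  intros Hn; apply le_INR in Hn; simpl (INR 12) in Hn; ring_simplify in Hn.
  assert (E : Ntilde n * (3 * INR n - 2) = INR n ^ 2) by (unfold Ntilde; field; lra).
  destruct (base_Int_part (Ntilde n)) as [H1 H2].
  assert (H3 : INR n / 3 <= Ntilde n) by nra.
  assert (H4 : (0 <= Int_part (Ntilde n))%Z) by (apply le_IZR; apply Rnot_lt_le; intros H;
    apply (lt_IZR _ 0) in H; assert (Int_part (Ntilde n) <= -1)%Z by lia; apply IZR_le in H0; lra).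
  assert (E2 : INR (Nfl n) = IZR (Int_part (Ntilde n)))
    by (unfold Nfl; rewrite INR_IZR_INZ, Z2Nat.id; auto).
  rewrite E2; split; [lra|]. split; nra.
Qed.

(** [pbin_compare] in both directions; [y] bounds the exponent [4 * W * D]. Its cubic term collects
    [4 * (192 + 2048)], and its last term comes from [1 / m] in [W] together with
    [D + 1 <= m / 8]. *)
Lemma prob_ratio_bounds (n : nat) (p D L : R) (x : nat) :
  let a := alpha p in
  let m := INR n * a in
  (12 <= n)%nat -> 0 < a <= 1/400 -> 0 < L <= D -> D + 1 <= m / 8 ->
  Rabs (m - INR x) <= D ->
  let r := prob_S n p x / BI (Nfl n) (ptilde n p) x in
  let y := 8960 * ((D + 1) ^ 3 / INR n ^ 2) + 1024 * a ^ 2 in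
  0 < r /\ 1 <= exp y * r + m / L ^ 2 /\ 1 <= exp y * / r + m / L ^ 2.
Proof.
  intros a m Hn Ha HL HD Hx r y.
  destruct (Nfl_bounds n Hn) as [N1 N2].
  assert (Hn0 : 12 <= INR n) by (apply le_INR in Hn; simpl in Hn; lra).
  assert (Hm : 0 < m) by (unfold m; apply Rmult_lt_0_compat; lra).
  set (N := Nfl n) in *. set (q := ptilde n p) in *.
  assert (HN : 0 < INR N) by lra.
  assert (Eq : INR N * q = m) by (unfold q, ptilde; fold N; fold a; unfold m; field; lra).
  assert (Hq : 0 <= q <= 4 * a).
  { split; [unfold q, ptilde; fold N; fold a; apply Rmult_le_pos;
      [apply Rmult_le_pos; lra|left; apply Rinv_0_lt_compat; auto]|].
    apply (Rmult_le_reg_l (INR N)); auto. rewrite Eq; unfold m. nra. }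
  destruct (run_list_sums n p) as [S1 S2]; [lia|]. fold a in S1, S2; fold m in S1.
  destruct (repeat_sums q N) as [S1' S2'].
  rewrite Eq in S1'.
  assert (Hl : small_list (4 * a) (run_list n p)) by (apply run_list_small; fold a; lra).
  assert (Hl' : small_list (4 * a) (repeat q N)).
  { intros c Hc; apply repeat_spec in Hc; subst c; auto. }
  (* The sums of squares differ by [a ^ 2] times the rounding error over [N], at most
     [3 n / (n / 4) = 12]; and [k * m = 12 * a ^ 2]. *)
  set (k := 12 * a / INR n).
  assert (Hk : 0 <= k) by (unfold k; apply Rmult_le_pos; [lra|left; apply Rinv_0_lt_compat; lra]).
  assert (Hk2 : Rabs (lsum (fun q => q * q) (run_list n p)
                      - lsum (fun q => q * q) (repeat q N)) <= k * m).
  { rewrite S2, S2'. replace (k * m) with (12 * a ^ 2) by (unfold k, m; field; lra).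
    assert (E : (3 * INR n - 2) * a ^ 2 - INR N * q ^ 2 =
      - (a ^ 2 * ((INR n ^ 2 - INR N * (3 * INR n - 2)) / INR N))).
    { unfold q, ptilde; fold N; fold a; field; lra. }
    assert (0 <= (INR n ^ 2 - INR N * (3 * INR n - 2)) / INR N <= 12).
    { split; [apply Rmult_le_pos; [lra|left; apply Rinv_0_lt_compat; auto]|].
      apply (Rmult_le_reg_r (INR N)); auto. unfold Rdiv; rewrite Rmult_assoc, Rinv_l by lra. lra. }
    rewrite E, Rabs_Ropp, Rabs_pos_eq by (apply Rmult_le_pos; [apply pow2_ge_0|lra]).
    rewrite (Rmult_comm 12). apply Rmult_le_compat_l; [apply pow2_ge_0|lra]. }
  assert (HDm : (D + 1) / m <= 1/8).
  { apply (Rmult_le_reg_r m); auto. unfold Rdiv at 1; rewrite Rmult_assoc, Rinv_l by lra. lra. }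
  set (W := 16 * k * ((D + 1) / m) + 128 * (4 * a) ^ 2 * (((D + 1) / m) ^ 2 + / m)).
  assert (HW : 4 * W * D <= y).
  { assert (0 < / INR n ^ 2) by (apply Rinv_0_lt_compat; nra).
    assert (E : W = 192 * (D + 1) * / INR n ^ 2 + 2048 * (D + 1) ^ 2 * / INR n ^ 2
                    + 2048 * a / INR n) by (unfold W, k, m; field; split; lra).
    assert (W1 : W <= 2240 * (D + 1) ^ 2 * / INR n ^ 2 + 2048 * a / INR n).
    { rewrite E. assert ((D + 1) * / INR n ^ 2 <= (D + 1) ^ 2 * / INR n ^ 2)
        by (apply Rmult_le_compat_r; nra). lra. }
    assert (W2 : 4 * W * D <= 4 * (2240 * (D + 1) ^ 2 * / INR n ^ 2 + 2048 * a / INR n) * (D + 1)).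
    { assert (0 <= 2240 * (D + 1) ^ 2 * / INR n ^ 2)
        by (apply Rmult_le_pos; [pose proof (pow2_ge_0 (D + 1)); lra|lra]).
      assert (0 <= 2048 * a / INR n)
        by (apply Rmult_le_pos; [lra|left; apply Rinv_0_lt_compat; lra]).
      nra. }
    eapply Rle_trans; [exact W2|]. unfold y.
    assert (a / INR n * (D + 1) <= a / INR n * (m / 8)).
    { apply Rmult_le_compat_l; auto. apply Rmult_le_pos; [lra|left; apply Rinv_0_lt_compat; lra]. }
    replace (a / INR n * (m / 8)) with (a ^ 2 / 8) in H0 by (unfold m; field; lra).
    replace (4 * (2240 * (D + 1) ^ 2 * / INR n ^ 2 + 2048 * a / INR n) * (D + 1)) with
      (8960 * ((D + 1) ^ 3 / INR n ^ 2) + 8192 * (a / INR n * (D + 1))) by (field; lra).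
    lra. }
  assert (Hexp : exp (4 * W * D) <= exp y).
  { destruct HW as [HW|HW]; [left; apply exp_increasing; auto|rewrite HW; lra]. }
  assert (Hb : 4 * a <= 1/100) by lra.
  destruct (pbin_compare _ _ _ k m D L W x Hb Hl Hl' Hm S1 S1' Hk Hk2 HL HDm Hx eq_refl)
    as [P1 [P2 P3]].
  rewrite Rabs_minus_sym in Hk2.
  destruct (pbin_compare _ _ _ k m D L W x Hb Hl' Hl Hm S1' S1 Hk Hk2 HL HDm Hx eq_refl)
    as [_ [_ P4]].
  assert (Er : r = pbin (run_list n p) x / pbin (repeat q N) x)
    by (unfold r; rewrite prob_S_pbin, BI_pbin; reflexivity).
  assert (Hr : 0 < r) by (rewrite Er; apply Rdiv_lt_0_compat; auto).
  replace (pbin (repeat q N) x / pbin (run_list n p) x) with (/ r) in P4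
    by (rewrite Er; field; lra).
  rewrite <- Er in P3.
  pose proof (Rinv_0_lt_compat r Hr).
  split; auto. split.
  - eapply Rle_trans; [exact P3|]. apply Rplus_le_compat_r, Rmult_le_compat_r; lra.
  - eapply Rle_trans; [exact P4|]. apply Rplus_le_compat_r, Rmult_le_compat_r; lra.
Qed.

(** The two inequalities read [(1 - z) exp (- y) <= r <= exp y / (1 - z)]. *)
Lemma squeeze_near_one (e y r z : R) :
  0 < e <= 1 -> y <= e / 16 -> z = e / 8 -> 0 < r ->
  1 <= exp y * r + z -> 1 <= exp y * / r + z -> Rabs (r - 1) < e.
Proof.
  intros He Hy -> Hr H1 H2.
  assert (Hexp : exp y <= 1 + e / 8).
  { pose proof (exp_ineq1_le (- y)) as H. rewrite exp_Ropp in H.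
    pose proof (exp_pos y).
    assert ((1 - e / 16) * exp y <= 1).
    { apply Rle_trans with (/ exp y * exp y); [|rewrite Rinv_l; lra].
      apply Rmult_le_compat_r; lra. }
    nra. }
  pose proof (exp_pos y).
  assert (H3 : (1 - e / 8) * r <= exp y).
  { apply (Rmult_le_compat_r r) in H2; [|lra].
    replace ((exp y * / r + e / 8) * r) with (exp y + e / 8 * r) in H2 by (field; lra). lra. }
  apply Rabs_def1; nra.
Qed.

Lemma Rabs_div_lt (u v d : R) : 0 < v -> Rabs (Rabs u / v - 0) < d -> Rabs u <= d * v.
Proof.
  intros Hv H; rewrite Rminus_0_r, Rabs_pos_eq in H.
  - apply (Rmult_lt_compat_r v) in H; auto.
    unfold Rdiv in H; rewrite Rmult_assoc, Rinv_l in H by lra. lra.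
  - apply Rmult_le_pos; [apply Rabs_pos|left; apply Rinv_0_lt_compat; auto].
Qed.

Lemma pow2_le_inv (u v : R) : 0 <= v -> u ^ 2 <= v ^ 2 -> u <= v.
Proof. intros Hv H; apply Rnot_lt_le; intros Hu; nra. Qed.

Theorem theorem4 (p : nat -> R) (x : nat -> nat) :
  (forall n, 0 < p n < 1) ->
  Un_cv p 0 ->
  cv_infty (fun n => INR n * p n) ->
  Un_cv (fun n => Rabs (INR (x n) - INR n * alpha (p n))
                  / Rmin (INR n * p n) (Rpower (INR n) (2/3))) 0 ->
  Un_cv (fun n => prob_S n (p n) (x n) / BI (Nfl n) (ptilde n (p n)) (x n)) 1.
Proof.
  intros Hp Hp0 Hnp Hx eps Heps.
  set (e := Rmin eps 1).
  assert (He : 0 < e <= 1 /\ e <= eps).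
  { unfold e; split; [split; [apply Rmin_glb_lt; lra|apply Rmin_r]|apply Rmin_l]. }
  (* [286720 = 32 * 8960], so the cubic term of the exponent uses at most [e / 32], half of what
     [squeeze_near_one] allows. *)
  set (d := e / 286720). assert (Hd : 0 < d <= 1/8) by (unfold d; lra).
  (* For [t >= T] the first summand yields [1 <= d * t ^ 4 / 3], the second [L <= d * t ^ 4 / 3],
     and the last [t >= 1]. *)
  set (T := 3 / d + 72 / (e * d ^ 2) + 1).
  assert (HT1 : 0 < 3 / d) by (apply Rdiv_lt_0_compat; lra).
  assert (Hed : 0 < e * d ^ 2) by (apply Rmult_lt_0_compat; [lra|apply pow_lt; lra]).
  assert (HT2 : 0 < 72 / (e * d ^ 2)) by (apply Rdiv_lt_0_compat; lra).
  destruct (Hp0 (e / 400)) as [n1 H1]; [lra|].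
  (* The 2 pays for [p <= 2 * alpha p]; then [m * e >= 4608 = 8 * 24 ^ 2], which is what
     [L <= m / 24] requires. *)
  destruct (Hnp (2 * (4608 / e))) as [n2 H2].
  destruct (Hx (d / 6)) as [n3 H3]; [lra|].
  destruct (INR_unbounded (T ^ 6)) as [n4 H4].
  exists (n1 + n2 + n3 + n4 + 12)%nat; intros n Hn.
  specialize (H1 n ltac:(lia)); specialize (H2 n ltac:(lia)); specialize (H3 n ltac:(lia)).
  cbv beta in H2, H3.
  specialize (Hp n). unfold Rdist in *.
  rewrite Rminus_0_r, Rabs_pos_eq in H1 by lra.
  assert (Hn12 : (12 <= n)%nat) by lia.
  assert (Hn0 : 12 <= INR n) by (apply le_INR in Hn12; simpl in Hn12; lra).
  (* In terms of [t], [n = t ^ 6], [n ^ (2/3) = t ^ 4] and [L] is of order [t ^ 3]. *)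
  set (t := Rpower (INR n) (1/6)).
  assert (Ht : 0 < t) by apply exp_pos.
  assert (Et : forall k, t ^ k = Rpower (INR n) (1/6 * INR k)).
  { intros k; rewrite <- Rpower_pow by auto; unfold t; apply Rpower_mult. }
  assert (E6 : INR n = t ^ 6).
  { rewrite Et. replace (1/6 * INR 6) with 1 by (simpl; field). rewrite Rpower_1; lra. }
  assert (E4 : Rpower (INR n) (2/3) = t ^ 4).
  { rewrite Et. f_equal; simpl; field. }
  assert (HtT : T <= t).
  { apply Rnot_lt_le; intros H. assert (t ^ 6 <= T ^ 6) by (apply pow_incr; lra).
    assert (INR n4 <= INR n) by (apply le_INR; lia). lra. }
  rewrite E4 in H3.
  set (a := alpha (p n)) in *. set (m := INR n * a) in *.
  assert (Ha : 0 < a <= e / 400 /\ p n <= 2 * a) by (unfold a, alpha; nra).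
  assert (Hm : 4608 / e <= m).
  { unfold m. assert (INR n * p n <= INR n * (2 * a)) by (apply Rmult_le_compat_l; lra). lra. }
  assert (Hem : 4608 <= m * e).
  { apply (Rmult_le_compat_r e) in Hm; [|lra].
    replace (4608 / e * e) with 4608 in Hm by (field; lra). lra. }
  assert (Hm0 : 4608 <= m) by nra.
  assert (t4 : 0 < t ^ 4) by (apply pow_lt; auto).
  assert (Hmin : 0 < Rmin (INR n * p n) (t ^ 4)) by (apply Rmin_glb_lt; nra).
  apply Rabs_div_lt in H3; auto.
  pose proof (Rmin_l (INR n * p n) (t ^ 4)) as M1; pose proof (Rmin_r (INR n * p n) (t ^ 4)) as M2.
  assert (Hdev1 : Rabs (m - INR (x n)) <= d * m / 3).
  { rewrite Rabs_minus_sym; eapply Rle_trans; [exact H3|].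
    assert (INR n * p n <= INR n * (2 * a)) by (apply Rmult_le_compat_l; lra).
    unfold m; nra. }
  assert (Hdev2 : Rabs (m - INR (x n)) <= d * t ^ 4 / 6).
  { rewrite Rabs_minus_sym; eapply Rle_trans; [exact H3|]. nra. }
  (* Makes the Chebyshev cost [m / L ^ 2] equal to [e / 8]. *)
  set (L := sqrt (8 * m / e)).
  assert (HL0 : 0 < 8 * m / e) by (apply Rdiv_lt_0_compat; lra).
  assert (HL : 0 < L) by (apply sqrt_lt_R0; auto).
  assert (EL : L ^ 2 = 8 * m / e) by (unfold L; rewrite <- Rsqr_pow2; apply Rsqr_sqrt; lra).
  assert (HL1 : L <= m / 24).
  { apply pow2_le_inv; [lra|]. rewrite EL. apply (Rmult_le_reg_r e); [lra|].
    replace (8 * m / e * e) with (8 * m) by (field; lra).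
    assert (4608 * m <= m * e * m) by (apply Rmult_le_compat_r; lra). lra. }
  assert (Hmt : m <= t ^ 6).
  { rewrite <- E6, <- (Rmult_1_r (INR n)). apply Rmult_le_compat_l; lra. }
  assert (HL2 : L <= d * t ^ 4 / 3).
  { apply pow2_le_inv; [nra|]. rewrite EL.
    assert (K1 : 72 <= t ^ 2 * (e * d ^ 2)).
    { assert (72 / (e * d ^ 2) <= t ^ 2) by (clear - HtT HT1 HT2; unfold T in HtT; nra).
      apply (Rmult_le_compat_r (e * d ^ 2)) in H; [|lra].
      replace (72 / (e * d ^ 2) * (e * d ^ 2)) with 72 in H by (field; split; lra). lra. }
    assert (K2 : 72 * t ^ 6 <= t ^ 2 * (e * d ^ 2) * t ^ 6)
      by (apply Rmult_le_compat_r; [left; apply pow_lt; auto|auto]).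
    apply (Rmult_le_reg_r e); [lra|].
    replace (8 * m / e * e) with (8 * m) by (field; lra).
    replace ((d * t ^ 4 / 3) ^ 2 * e) with (t ^ 2 * (e * d ^ 2) * t ^ 6 / 9) by field. lra. }
  assert (H1t : 1 <= d * t ^ 4 / 3).
  { assert (3 <= d * t).
    { assert (3 / d <= t) by (unfold T in HtT; lra).
      apply (Rmult_le_compat_l d) in H; [|lra].
      replace (d * (3 / d)) with 3 in H by (field; lra). lra. }
    assert (1 <= t ^ 3) by (apply pow_R1_Rle; unfold T in HtT; lra).
    replace (d * t ^ 4) with (d * t * t ^ 3) by ring. clear - H H0; nra. }
  set (D := Rabs (m - INR (x n)) + L).
  pose proof (Rabs_pos (m - INR (x n))) as HR.
  destruct (prob_ratio_bounds n (p n) D L (x n)) as [R0 [R1 R2]];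
    fold a; fold m; auto; try (unfold D; lra).
  (* Each of [|m - x|], [L] and 1 is at most [m / 24]. *)
  { assert (d * m <= 1/8 * m) by (apply Rmult_le_compat_r; lra). unfold D; lra. }
  fold a in R1, R2; fold m in R1, R2.
  apply Rlt_le_trans with e; [|lra].
  eapply squeeze_near_one; [apply He| |  |exact R0|exact R1|exact R2].
  (* Each of the three parts of [D + 1] is at most [d * t ^ 4 / 3], and [(t ^ 4) ^ 3 = n ^ 2]: here
     the scale [n ^ (2/3)] is decisive. *)
  - assert (HD3 : (D + 1) ^ 3 <= (d * t ^ 4) ^ 3) by (apply pow_incr; unfold D; lra).
    assert (Hn2 : 0 < INR n ^ 2) by (apply pow_lt; lra).
    assert ((D + 1) ^ 3 / INR n ^ 2 <= d ^ 3).
    { apply (Rmult_le_reg_r (INR n ^ 2)); auto.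
      replace ((D + 1) ^ 3 / INR n ^ 2 * INR n ^ 2) with ((D + 1) ^ 3) by (field; lra).
      eapply Rle_trans; [exact HD3|]. rewrite E6; right; ring. }
    assert (d ^ 3 <= d) by (clear - Hd; nra).
    assert (a ^ 2 <= 1/400 * (e / 400)) by (clear - Ha He; nra).
    unfold d in *; lra.
  - rewrite EL; field; lra.
Qed.
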